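(* The graph $\mathcal{H}$, which is an $egr(32,5,5,12)$, is an extremal edge-girth-regular graph for the triple $(5,5,12)$; that is, $n(5,5,12)=32$.
   Context: All graphs are simple (no loops, no multiple edges). An $egr(v,k,g,\lambda)$ (edge-girth-regular graph) is a $k$-regular graph of order (number of vertices) $v$ and girth $g$ such that each of its edges is contained in exactly $\lambda$ distinct $g$-cycles (cycles of length $g$). For a fixed triple $(k,g,\lambda)$, $n(k,g,\lambda)$ denotes the smallest $v$ for which an $egr(v,k,g,\lambda)$ exists. An $egr(v,k,g,\lambda)$ is called extremal for the triple $(k,g,\lambda)$ if $v=n(k,g,\lambda)$. Construction of $\mathcal{H}$. Let $\mathbb{F}_4=\{0,1,\alpha,\alpha^2\}$ with $\alpha^2=\alpha+1$. Let $\mathcal{B}_4$ be the bipartite graph whose vertices are the points $(x,y)$ and the lines $[m,b]$ with $x,y,m,b\in\mathbb{F}_4$ (so $16+16=32$ vertices), where $(x,y)$ is adjacent to $[m,b]$ if and only if $y=mx+b$. The graph $\mathcal{H}$ has the same vertex set as $\mathcal{B}_4$ and edge set $E(\mathcal{H})=E(\mathcal{B}_4)\cup\mathcal{E}$, where $\mathcal{E}$ consists of the edges joining $(i,0)$ to $(i,1)$ and $(i,\alpha)$ to $(i,\alpha^2)$ for every $i\in\mathbb{F}_4$, and the edges joining $[j,0]$ to $[j,\alpha]$ and $[j,1]$ to $[j,\alpha^2]$ for every $j\in\mathbb{F}_4$. *)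

(* Defs.v *)
From mathcomp Require Import all_boot all_algebra.

Set Implicit Arguments.
Unset Strict Implicit.
Unset Printing Implicit Defensive.

Import GRing.Theory.
Local Open Scope ring_scope.

(* A simple graph is a symmetric irreflexive relation on a finite type. *)
Definition simple_graph (T : finType) (e : rel T) : Prop :=
  symmetric e /\ irreflexive e.

Definition regular (T : finType) (e : rel T) (k : nat) : Prop :=
  forall x : T, #|[set y | e x y]| = k.

(* The bound on the size is needed because [ucycle e [:: x; y]] holds for
   every edge xy. *)
Definition graph_cycle (T : finType) (e : rel T) (s : seq T) : bool :=
  (3 <= size s)%N && ucycleb e s.

Definition cycle_edges (T : finType) (s : seq T) : {set {set T}} :=
  [set [set x; next s x] | x in s].

(* Cycles are counted as subgraphs, so they are identified with their edge
   sets: a g-cycle is counted once, not once per starting point and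
   direction. *)
Definition cycles_of_length (T : finType) (e : rel T) (g : nat) :
    {set {set {set T}}} :=
  [set cycle_edges (tval t) | t : g.-tuple T & graph_cycle e t].

Definition has_girth (T : finType) (e : rel T) (g : nat) : Prop :=
  (exists2 s : seq T, graph_cycle e s & size s = g) /\
  (forall s : seq T, graph_cycle e s -> (g <= size s)%N).

Definition egr (T : finType) (e : rel T) (v k g lambda : nat) : Prop :=
  [/\ simple_graph e,
      #|T| = v,
      regular e k,
      has_girth e g &
      forall x y : T, e x y ->
        #|[set C in cycles_of_length e g | [set x; y] \in C]| = lambda].

Definition egr_exists (v k g lambda : nat) : Prop :=
  exists (T : finType) (e : rel T), egr e v k g lambda.

(* [egr_min_order k g lambda v] says that n(k, g, lambda) is defined and
   equal to v. *)
Definition egr_min_order (k g lambda v : nat) : Prop :=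
  egr_exists v k g lambda /\
  (forall w : nat, egr_exists w k g lambda -> (v <= w)%N).

Definition extremal_egr (T : finType) (e : rel T) (v k g lambda : nat) : Prop :=
  egr e v k g lambda /\ egr_min_order k g lambda v.

Section GraphH.

Variables (F : finFieldType) (alpha : F).

(* [inl (x, y)] is the point (x, y) and [inr (m, b)] is the line [m, b]. *)
Definition vertex : finType := ((F * F) + (F * F))%type.

Definition incident (p l : F * F) : bool := p.2 == l.1 * p.1 + l.2.

Definition B_rel : rel vertex := fun u w =>
  match u, w with
  | inl p, inr l => incident p l
  | inr l, inl p => incident p l
  | _, _ => false
  end.

Definition extra_rel : rel vertex := fun u w =>
  match u, w with
  | inl p, inl q =>
      (p.1 == q.1) &&
      ([set p.2; q.2] \in [:: [set 0; 1]; [set alpha; alpha ^+ 2]])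
  | inr l, inr r =>
      (l.1 == r.1) &&
      ([set l.2; r.2] \in [:: [set 0; alpha]; [set 1; alpha ^+ 2]])
  | _, _ => false
  end.

Definition H_rel : rel vertex := fun u w => B_rel u w || extra_rel u w.

End GraphH.

(* Main.v *)
Require Import Defs.
From mathcomp Require Import all_boot all_algebra all_field.
From mathcomp Require Import zify ring.

(** Why the order 32 is optimal.

    Let G be an egr(v,5,5,12), let xy be an edge, and let W(x) be the set of
    ends of walks of length two from x.  As the girth is 5, W(x) has
    1 + 5 * 4 = 21 elements, and a 5-cycle through xy is determined by its
    vertex opposite to xy, which may be any element of the intersection of
    W(x) and W(y) ([five_cycles_through_edge]).  So this intersection has 12
    elements, the union of W(x) and W(y) has 21 + 21 - 12 = 30, and v >= 30.
    The handshake lemma excludes v = 31.  If v = 30, the union is everything: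
    for every edge xy, each vertex has a neighbour in N(x) or in N(y).

    This covering property is strong enough to exclude v = 30 by a short case
    analysis ([no_tight_relation]).  Its cases are partial descriptions of a
    labelled graph (some known edges and some known non-edges); a case is
    split by asking which member of N(x) or N(y) is adjacent to a given vertex
    w, and no answer may close a cycle of length less than 5 or exceed the
    degree 5.  Cases that differ by a permutation of the labels are treated
    once.  The analysis is recorded as a certificate with about 1200 nodes and
    is verified by computation; [refutes_sound] justifies each of its steps.

    For the graph H itself, the same description of the 5-cycles through an
    edge reduces the defining properties of an egr to a finite computation on
    an explicit adjacency table ([egr_of_table]), once the elements of the
    field have been listed as 0, 1, alpha, alpha^2. *)

Set Implicit Arguments.
Unset Strict Implicit.
Unset Printing Implicit Defensive.

Import GRing.Theory.
Local Open Scope nat_scope.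

(** * Graphs of girth five *)

Definition triangle_free (T : Type) (e : rel T) : Prop :=
  forall x y z, e x y -> e y z -> ~~ e x z.

(** Every closed walk of length four backtracks; on a simple graph this says that
    there is no 4-cycle. *)
Definition square_free (T : Type) (e : rel T) : Prop :=
  forall x y a b, e x a -> e a y -> e x b -> e b y -> x = y \/ a = b.

Definition two_walks (T : finType) (e : rel T) (x : T) : {set T} :=
  [set z | [exists a, e x a && e a z]].

Lemma two_walksP (T : finType) (e : rel T) x z :
  reflect (exists2 a, e x a & e a z) (z \in two_walks e x).
Proof.
rewrite inE; apply: (iffP existsP) => [[a /andP[]]|[a xa az]]; first by exists a.
by exists a; rewrite xa az.
Qed.

Lemma simple_neq (T : finType) (e : rel T) x y : irreflexive e -> e x y -> x != y.
Proof. by move=> irr; apply: contraTneq => ->; rewrite irr. Qed.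

Lemma girth5_triangle_free (T : finType) (e : rel T) :
  simple_graph e -> has_girth e 5 -> triangle_free e.
Proof.
move=> [sym irr] [_ short] x y z xy yz; apply/negP=> xz.
have /short // : graph_cycle e [:: x; y; z].
rewrite /graph_cycle /ucycleb /= !inE negb_or xy yz (sym z x) xz /=.
by rewrite !(simple_neq irr).
Qed.

Lemma girth5_square_free (T : finType) (e : rel T) :
  simple_graph e -> has_girth e 5 -> square_free e.
Proof.
move=> [sym irr] [_ short] x y a b xa ay xb by_.
have [->|xy] := eqVneq x y; first by left.
have [->|ab] := eqVneq a b; first by right.
have /short // : graph_cycle e [:: x; a; y; b].
rewrite /graph_cycle /ucycleb /= !inE !negb_or.
rewrite xa ay (sym y b) by_ (sym b x) xb /=.
by rewrite xy ab !(simple_neq irr) // sym.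
Qed.

Lemma girth5_intro (T : finType) (e : rel T) :
  simple_graph e -> triangle_free e -> square_free e ->
  (exists2 s : seq T, graph_cycle e s & size s = 5) -> has_girth e 5.
Proof.
move=> [sym irr] tri sqr ex5; split=> // s /and3P[s3 cyc us].
rewrite leqNgt; apply/negP=> s5.
case: s s3 s5 cyc us => [|x [|y [|z [|t [|? ?]]]]] //= _ _.
- case/and4P=> xy yz zx _ _; move: (tri _ _ _ xy yz).
  by rewrite sym zx.
- case/and5P=> xy yz zt tx _ /and4P[xn yn zn _].
  have [xz|yt] := sqr x z y t xy yz (etrans (sym _ _) tx) (etrans (sym _ _) zt).
    by move: xn; rewrite xz !inE eqxx orbT.
  by move: yn; rewrite yt !inE eqxx orbT.
Qed.

(** Of the [k * k] walks of length two that start at [x], exactly [k] return to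
    [x]; the others have distinct ends because there are no 4-cycles. *)
Lemma card_two_walks (T : finType) (e : rel T) (k : nat) x :
  simple_graph e -> square_free e -> regular e k -> 0 < k ->
  #|two_walks e x| + k = (k * k).+1.
Proof.
move=> [sym irr] sqr reg k0.
have deg y : \sum_(a | e y a) 1 = k.
  by rewrite sum1_card -(reg y) cardsE; apply: eq_card.
(* The number of walks of length two from [x], counted by their ends. *)
have kk : \sum_(z : T) \sum_(a | e x a) e a z = k * k.
  transitivity (\sum_(a | e x a) 1 * k); last by rewrite -big_distrl /= deg.
  rewrite exchange_big /=; apply: eq_bigr => a _; rewrite mul1n -(deg a).
  by rewrite [RHS]big_mkcond; apply: eq_bigr => z _; case: (e a z).
have xx : x \in two_walks e x.
  have : 0 < \sum_(a | e x a) 1 by rewrite deg.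
  rewrite lt0n sum_nat_eq0 => /forall_inPn[a xa _].
  by apply/two_walksP; exists a; rewrite // sym.
rewrite (cardsD1 x) xx add1n addSn -kk (bigD1 x) //=; congr (_.+1).
rewrite [X in _ = X + _](eq_bigr (fun _ => 1)) => [|a xa]; last by rewrite sym xa.
rewrite deg addnC; congr (_ + _).
rewrite -sum1_card big_mkcond [RHS]big_mkcond /=; apply: eq_bigr => z _.
rewrite !inE; case: (eqVneq z x) => //= zx.
case: ifP => [/existsP[a /andP[xa az]]|/existsPn none].
  rewrite (bigD1 a) //= az big1 ?addn0 // => b /andP[xb ba].
  case: (boolP (e b z)) => // bz; case: (sqr x z a b xa az xb bz) => eq_.
    by rewrite eq_ eqxx in zx.
  by rewrite eq_ eqxx in ba.
rewrite big1 // => a xa; case: (boolP (e a z)) => // az.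
by have := none a; rewrite xa az.
Qed.

Lemma mem_cycle_edges (T : finType) (s : seq T) D :
  reflect (exists2 x, x \in s & D = [set x; next s x]) (D \in cycle_edges s).
Proof. exact: imsetP. Qed.

Lemma cycle_edges_rot (T : finType) i (s : seq T) :
  uniq s -> cycle_edges (rot i s) = cycle_edges s.
Proof.
move=> us; apply/setP=> D; apply/mem_cycle_edges/mem_cycle_edges=> -[x xs ->];
  exists x; rewrite ?next_rot //; by rewrite mem_rot in xs *.
Qed.

Lemma cycle_edges5 (T : finType) (a b c d f : T) : uniq [:: a; b; c; d; f] ->
  cycle_edges [:: a; b; c; d; f] =
  [set [set a; b]; [set b; c]; [set c; d]; [set d; f]; [set f; a]].
Proof.
move=> us; set s := [:: _; _; _; _; _].
have [na nb nc nd nf] : [/\ next s a = b, next s b = c, next s c = d, next s d = f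
    & next s f = a].
  move: us; rewrite /= !inE !negb_or.
  case/and5P=> /and4P[ab ac ad af] /and3P[bc bd bf]
    /andP[cd cf] df _.
  rewrite /s /next /= !eqxx.
  rewrite !(eq_sym _ a) (negPf ab) (negPf ac) (negPf ad) (negPf af).
  rewrite !(eq_sym _ b) (negPf bc) (negPf bd) (negPf bf).
  by rewrite !(eq_sym _ c) (negPf cd) (negPf cf) (eq_sym f) (negPf df).
apply/setP=> D; rewrite !inE; apply/mem_cycle_edges/idP.
  case=> x; rewrite !inE -!orbA => /or4P[|||/orP[]] /eqP-> ->;
  by rewrite ?na ?nb ?nc ?nd ?nf eqxx ?orbT.
rewrite -!orbA => /or4P[|||/orP[]] /eqP->;
  [exists a|exists b|exists c|exists d|exists f];
  by rewrite ?na ?nb ?nc ?nd ?nf // !inE eqxx ?orbT.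
Qed.

(** * Five-cycles through an edge *)

Section FiveCyclesThroughAnEdge.

Variables (T : finType) (e : rel T).
Hypotheses (sim : simple_graph e) (tri : triangle_free e) (sqr : square_free e).
Variables x y : T.
Hypothesis xy : e x y.

Let sym : symmetric e := sim.1.
Let irr : irreflexive e := sim.2.

(* The middle vertex of the walk of length two from [u] to [z]; it is unique
   when [u != z]. *)
Let between u z := odflt u [pick a | e u a && e a z].

Let betweenP u z : z \in two_walks e u -> e u (between u z) /\ e (between u z) z.
Proof.
move=> /two_walksP[a ua az]; rewrite /between; case: pickP => [b /andP[]|none] //=.
by have := none a; rewrite ua az.
Qed.

Let between_eq u z a : u != z -> e u a -> e a z -> between u z = a.
Proof.
move=> uz ua az; have /betweenP[ub bz] : z \in two_walks e u.
  by apply/two_walksP; exists a.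
by case: (sqr ub bz ua az) => // eq_uz; rewrite eq_uz eqxx in uz.
Qed.

Definition opposite_cycle z :=
  cycle_edges [:: x; y; between y z; z; between x z].

Let opposite := two_walks e x :&: two_walks e y.

Let opposite_far z : z \in opposite -> [/\ z != x, z != y, ~~ e x z & ~~ e y z].
Proof.
rewrite inE => /andP[/two_walksP[a xa az] /two_walksP[b yb bz]]; split.
- by apply/eqP=> zx; subst z; move: (tri xy yb); rewrite sym bz.
- by apply/eqP=> zy; subst z; move: (tri xa az); rewrite xy.
- exact: tri xa az.
- exact: tri yb bz.
Qed.

Let opposite_graph_cycle z : z \in opposite ->
  graph_cycle e [:: x; y; between y z; z; between x z].
Proof.
move=> zo; have [zx zy nxz nyz] := opposite_far zo.
move: zo; rewrite inE => /andP[/betweenP[xa az] /betweenP[yb bz]].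
set a := between x z in xa az *; set b := between y z in yb bz *.
rewrite /graph_cycle /ucycleb /= xy yb bz (sym z a) az (sym a x) xa /=.
rewrite !inE !negb_or (simple_neq irr xy) (simple_neq irr xa) (simple_neq irr yb).
rewrite (simple_neq irr bz) (eq_sym x z) (eq_sym y z) zx zy (eq_sym z a).
rewrite (simple_neq irr az) /= !andbT.
apply/and3P; split.
- by apply: contraNneq nxz => ->.
- by apply: contraNneq nyz => ->.
- by apply/eqP=> ab; move: (tri xy yb); rewrite ab xa.
Qed.

(** The edge of the cycle that joins [between y z] to [z] gives [z] back: no other
    vertex of a 5-cycle through [xy] is at distance two from both [x] and [y]. *)
Lemma opposite_cycle_inj : {in opposite &, injective opposite_cycle}.
Proof.
move=> z z' zo zo' eqC.
have /and3P[_ _ us] := opposite_graph_cycle zo.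
have /and3P[_ _ us'] := opposite_graph_cycle zo'.
have : [set between y z; z] \in opposite_cycle z'.
  by rewrite -eqC /opposite_cycle cycle_edges5 // !inE eqxx !orbT.
have [zx zy nxz nyz] := opposite_far zo.
move: zo'; rewrite inE => /andP[/betweenP[xa _] /betweenP[yb _]].
have za : z != between x z' by apply: contraNneq nxz => ->.
have zb : z != between y z' by apply: contraNneq nyz => ->.
rewrite /opposite_cycle cycle_edges5 // !inE -!orbA.
have /[swap] : z \in [set between y z; z] by rewrite !inE eqxx orbT.
by case/or4P=> [|||/orP[]] /eqP->;
   rewrite !inE ?(negPf zx) ?(negPf zy) ?(negPf za) ?(negPf zb) ?orbF //= => /eqP.
Qed.

(** A 5-cycle through [xy] consists of [xy], its opposite vertex [z] and the
    middle vertices of the walks from [x] and [y] to [z], which [z] determines. *)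
Lemma five_cycles_through_edge :
  #|[set C in cycles_of_length e 5 | [set x; y] \in C]| =
  #|two_walks e x :&: two_walks e y|.
Proof.
rewrite -(card_in_imset opposite_cycle_inj); congr #|pred_of_set _|.
apply/setP=> C; rewrite inE; apply/andP/imsetP=> [[]|[z zo ->]]; last first.
  have gc := opposite_graph_cycle zo; split.
    by apply/imsetP; exists [tuple x; y; between y z; z; between x z];
      rewrite ?inE.
  have /and3P[_ _ us] := gc.
  by rewrite /opposite_cycle cycle_edges5 // !inE eqxx.
case/imsetP=> t; rewrite inE => gt -> /mem_cycle_edges[p pt eq_xy].
have /and3P[_ cyc us] := gt.
case: (rot_to pt) => i s' rot_i.
have sz : size (rot i t) = 5 by rewrite size_rot size_tuple.
move: eq_xy; rewrite -(next_rot i us) -(cycle_edges_rot i us).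
have urot : uniq (rot i t) by rewrite rot_uniq.
have crot : cycle e (rot i t) by rewrite rot_cycle.
move: sz urot crot; rewrite rot_i.
case: s' {rot_i} => [|q [|c [|d [|f [|? ?]]]]] //= _ us' /and5P[pq qc cd df].
rewrite andbT => fp.
rewrite eqxx => eq_xy; have xneqy := simple_neq irr xy.
have [] : x \in [set p; q] /\ y \in [set p; q] by rewrite -eq_xy !inE !eqxx orbT.
have [pd qd] : p != d /\ q != d.
  by case/and5P: us'; rewrite !inE !negb_or => /and4P[_ _ -> _] /and3P[_ -> _].
have df' : e f d by rewrite sym.
have pf : e p f by rewrite sym.
have dP : d \in two_walks e p :&: two_walks e q.
  by rewrite inE; apply/andP; split; apply/two_walksP; [exists f|exists c].
have pdf := between_eq pd pf df'; have qdc := between_eq qd qc cd.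
(* The cycle, started at [p], traverses [xy] in one direction or the other. *)
rewrite !inE => /orP[]/eqP xE /orP[]/eqP yE; try by rewrite xE yE eqxx in xneqy.
  by exists d; rewrite /opposite_cycle /opposite xE yE ?pdf ?qdc.
have dO : d \in opposite by rewrite /opposite xE yE setIC.
exists d => //; have /and3P[_ _] := opposite_graph_cycle dO.
rewrite /opposite_cycle xE yE pdf qdc => uO; rewrite !cycle_edges5 //.
apply/setP=> D; rewrite !inE (setUC [set p]) (setUC [set f]) (setUC [set d]).
rewrite (setUC [set c]) (setUC [set q] [set c]).
by do 5!case: (D == _).
Qed.

End FiveCyclesThroughAnEdge.

(** * Labelled graphs on thirty vertices *)

(** What an egr(30,5,5,12) becomes when its vertices are named 0, ..., 29.  The
    field [tight_cover] is the covering property of edges, and carries all that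
    is used of the number 12. *)
Record tight (e : rel nat) : Prop := Tight {
  tight_sym : symmetric e;
  tight_irr : irreflexive e;
  tight_bound : forall u v, e u v -> v < 30;
  tight_degree : forall u, u < 30 -> count (e u) (iota 0 30) = 5;
  tight_triangle : forall u v w, e u v -> e v w -> ~~ e u w;
  tight_square : forall u v a b,
    e u a -> e a v -> e u b -> e b v -> u = v \/ a = b;
  tight_cover : forall x a w,
    e x a -> w < 30 -> exists2 u, e w u & e x u || e a u
}.

(** Relabellings are products of transpositions, so that they are bijective by
    construction. *)
Definition swap (p : nat * nat) (i : nat) : nat :=
  if i == p.1 then p.2 else if i == p.2 then p.1 else i.

Definition shuffle (ps : seq (nat * nat)) (i : nat) : nat :=
  foldl (fun j p => swap p j) i ps.

Definition in_range (p : nat * nat) : bool := (p.1 < 30) && (p.2 < 30).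

Lemma swapK p : involutive (swap p).
Proof.
move=> i; rewrite /swap; case: (eqVneq i p.1) => [->|ip1].
  by rewrite eqxx; case: eqP.
by case: (eqVneq i p.2) => [->|ip2]; rewrite ?eqxx // (negPf ip1) (negPf ip2).
Qed.

Lemma swap_lt p i : in_range p -> (swap p i < 30) = (i < 30).
Proof.
case/andP=> p1 p2; rewrite /swap.
case: (eqVneq i p.1) => [->|_]; first by rewrite p1 p2.
by case: (eqVneq i p.2) => [->|_]; rewrite ?p1 ?p2.
Qed.

Lemma tight_swap e p :
  in_range p -> tight e -> tight (fun i j => e (swap p i) (swap p j)).
Proof.
move=> rp [sym irr bnd deg tri sqr cov]; split.
- by move=> i j /=; rewrite sym.
- by move=> i /=; rewrite irr.
- by move=> u v /bnd; rewrite swap_lt.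
- move=> u u30; rewrite -[RHS](deg (swap p u)) ?swap_lt //.
  rewrite -(count_map (swap p) (e (swap p u))); apply: permP.
  apply: uniq_perm; rewrite ?iota_uniq //.
    by rewrite map_inj_uniq ?iota_uniq //; apply: can_inj (swapK p).
  move=> i; rewrite -[i in LHS](swapK p) mem_map; last exact: can_inj (swapK p).
  by rewrite !mem_iota /= !add0n swap_lt.
- by move=> u v w; apply: tri.
- move=> u v a b ua av ub bv.
  by case: (sqr _ _ _ _ ua av ub bv) => /(can_inj (swapK p)); [left|right].
- move=> x a w xa w30; have [|u wu xu] := cov _ _ (swap p w) xa.
    by rewrite swap_lt.
  by exists (swap p u); rewrite !swapK.
Qed.

Lemma tight_shuffle e ps : all in_range ps -> tight e ->
  tight (fun i j => e (shuffle ps i) (shuffle ps j)).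
Proof.
move=> + te; elim: ps => [|p ps IHps] //= /andP[rp /IHps]; exact: tight_swap.
Qed.

(** * Partial descriptions of a labelled graph *)

(** Rows and tables are implicitly padded with [false], so a table may be ragged
    and the empty row is the empty set of vertices. *)
Definition row := seq bool.
Definition table := seq row.
Definition entry (m : table) (i j : nat) : bool := nth false (nth [::] m i) j.

Fixpoint join (r s : row) : row :=
  match r, s with
  | a :: r', b :: s' => (a || b) :: join r' s'
  | [::], _ => s
  | _, [::] => r
  end.

Lemma nth_join r s i : nth false (join r s) i = nth false r i || nth false s i.
Proof.
elim: r s i => [|a r IHr] [|b s] [|i] //=; by rewrite ?orbF ?IHr.
Qed.

Definition expand (m : table) (r : row) : row := foldr join r (mask r m).

Lemma nth_expand m r j : nth false (expand m r) j ->
  nth false r j \/ exists2 i, nth false r i & entry m i j.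
Proof.
have main (r' t : row) : nth false (foldr join t (mask r' m)) j ->
    nth false t j \/ exists2 i, nth false r' i & entry m i j; last exact: main.
elim: m r' => [|s m IHm] [|[] r'] //=; try by left.
- rewrite nth_join => /orP[sj|/IHm[tj|[i r'i mij]]]; first by right; exists 0.
    by left.
  by right; exists i.+1.
- by move=> /IHm[tj|[i r'i mij]]; [left | right; exists i.+1].
Qed.

Definition mark (i j : nat) (m : table) : table :=
  set_nth [::] m i (set_nth false (nth [::] m i) j true).

Lemma entry_mark i j m u v :
  entry (mark i j m) u v = entry m u v || (u == i) && (v == j).
Proof.
rewrite /entry /mark nth_set_nth /=; case: (eqVneq u i) => [->|_].
  by rewrite nth_set_nth /=; case: (v == j); rewrite /= ?orbT ?orbF.
by rewrite orbF.
Qed.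

Definition mark2 (i j : nat) (m : table) : table := mark i j (mark j i m).

Definition table_sym (m : table) : Prop := forall u v, entry m u v = entry m v u.

Lemma entry_mark2 i j m u v : entry (mark2 i j m) u v =
  [|| entry m u v, (u == j) && (v == i) | (u == i) && (v == j)].
Proof. by rewrite !entry_mark orbA. Qed.

Lemma mark2_sym i j m : table_sym m -> table_sym (mark2 i j m).
Proof.
move=> ms u v; rewrite !entry_mark2 ms; congr (_ || _).
by rewrite andbC orbC andbC.
Qed.

(** The pairs in the first table are known edges, those in the second one are
    known non-edges. *)
Definition state := (table * table)%type.

Definition consistent (e : rel nat) (S : state) : Prop :=
  (forall u v, entry S.1 u v -> e u v) /\
  (forall u v, entry S.2 u v -> ~~ e u v).

Definition state_sym (S : state) : Prop := table_sym S.1 /\ table_sym S.2.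

Definition refuted (S : state) : Prop :=
  forall e, tight e -> ~ consistent e S.

Definition link (w u : nat) (S : state) : state := (mark2 w u S.1, S.2).

Definition unlink (w : nat) (us : seq nat) (S : state) : state :=
  (S.1, foldr (mark2 w) S.2 us).

Lemma link_sym w u S : state_sym S -> state_sym (link w u S).
Proof. by case=> s1 s2; split=> //; apply: mark2_sym. Qed.

Lemma unlink_sym w us S : state_sym S -> state_sym (unlink w us S).
Proof.
case=> s1 s2; split=> //=; elim: us => //= u us IHus; exact: mark2_sym.
Qed.

Lemma consistent_link e w u S : tight e -> e w u ->
  consistent e S -> consistent e (link w u S).
Proof.
move=> te wu [cE cN]; split=> //= i j; rewrite entry_mark2.
by case/or3P=> [/cE //|/andP[/eqP-> /eqP->]|/andP[/eqP-> /eqP->]] //;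
   rewrite (tight_sym te).
Qed.

Lemma consistent_unlink e w us S : tight e -> (forall u, u \in us -> ~~ e w u) ->
  consistent e S -> consistent e (unlink w us S).
Proof.
move=> te + [cE cN]; split=> //=; elim: us H => //= u us IHus wus i j.
rewrite entry_mark2 => /or3P[|/andP[/eqP-> /eqP->]|/andP[/eqP-> /eqP->]].
- by apply: IHus => v vus; apply: wus; rewrite inE vus orbT.
- by rewrite (tight_sym te) wus ?mem_head.
- by rewrite wus ?mem_head.
Qed.

Definition saturated (r : row) : bool := 5 <= count id r.

Lemma count_nth (r : row) : count id r = count (nth false r) (iota 0 (size r)).
Proof. by rewrite -[in LHS](mkseq_nth false r) /mkseq count_map. Qed.

(** The five known neighbours of [w] are all its neighbours. *)
Lemma saturatedP e S w u : tight e -> consistent e S ->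
  saturated (nth [::] S.1 w) -> e w u -> entry S.1 w u.
Proof.
move=> te [cE _]; rewrite /saturated count_nth -size_filter => sat wu.
set known := filter _ _ in sat.
have w30 : w < 30 by apply: (tight_bound te (u := u)); rewrite (tight_sym te).
have sub : {subset known <= filter (e w) (iota 0 30)}.
  move=> v; rewrite !mem_filter mem_iota => /andP[/cE wv _].
  by rewrite wv mem_iota (tight_bound te wv).
have uk : uniq known by rewrite filter_uniq ?iota_uniq.
have [|_ eqk] := uniq_min_size uk sub.
  by rewrite size_filter (tight_degree te w30).
have : u \in known by rewrite eqk mem_filter wu mem_iota (tight_bound te wu).
by rewrite mem_filter => /andP[].
Qed.

(** The vertices that known edges connect to [w] by a walk of length at most
    three.  A new edge from [w] to one of them would close a cycle of length at
    most four. *)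
Definition ball3 (m : table) (w : nat) : row :=
  iter 3 (expand m) (set_nth false [::] w true).

Definition barred (S : state) (w : nat) : row :=
  if saturated (nth [::] S.1 w) then nseq 30 true
  else join (ball3 S.1 w) (join (nth [::] S.2 w) (map saturated S.1)).

Lemma barredP e S w u : tight e -> state_sym S -> consistent e S ->
  nth false (barred S w) u -> e w u -> entry S.1 w u.
Proof.
move=> te [symE _] cS + wu; have [cE cN] := cS.
have uw : e u w by rewrite (tight_sym te).
rewrite /barred; case: ifP => [sat _|_]; first exact: saturatedP sat wu.
rewrite !nth_join => /or3P[|/cN/negP//|]; last first.
  have [uS|uS] := ltnP u (size S.1); last by rewrite nth_default ?size_map.
  by rewrite (nth_map [::]) // => /(saturatedP te cS)/(_ uw); rewrite symE.
have step r v : nth false (expand S.1 r) v ->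
  nth false r v \/ exists2 i, nth false r i & entry S.1 i v by exact: nth_expand.
have start v : nth false (set_nth false [::] w true) v -> v = w.
  by rewrite nth_set_nth /=; case: eqP => // _; rewrite nth_nil.
have near v : nth false (iter 1 (expand S.1) (set_nth false [::] w true)) v ->
    v = w \/ entry S.1 w v.
  by case/step=> [/start->|[i /start->]]; [left | right].
have close v : nth false (iter 2 (expand S.1) (set_nth false [::] w true)) v ->
    [\/ v = w, entry S.1 w v | exists2 i, entry S.1 w i & entry S.1 i v].
  case/step=> [/near[->|wv]|[i /near[->|wi] iv]].
  - exact: Or31.
  - exact: Or32.
  - exact: Or32.
  - by apply: Or33; exists i.
(* Known walks of length 0, 1, 2 and 3 from [w] to [u]: with the edge [wu] the
   first is a loop, the third a triangle and the last a closed walk of length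
   four, which has to backtrack along [wu] itself. *)
have loop : w <> u by move=> eq_wu; rewrite eq_wu (tight_irr te) in wu.
have tri i : e w i -> e i u -> False.
  by move=> wi iu; move: (tight_triangle te wi iu); rewrite wu.
case/step=> [/close[eq_uw|//|[i /cE wi /cE iu]]|[j /close[->//|wj|[i wi ij]] ju]].
- by case: loop.
- by case: (tri _ wi iu).
- by case: (tri _ (cE _ _ wj) (cE _ _ ju)).
have uj : e u j by rewrite (tight_sym te) (cE _ _ ju).
case: (tight_square te (cE _ _ wi) (cE _ _ ij) wu uj) => [->//|<-//].
Qed.

Definition options (S : state) (w : nat) (target : row) : seq nat :=
  let out := barred S w in
  [seq u <- iota 0 30 | nth false target u && ~~ nth false out u].

Lemma mem_options e S w target u : tight e -> state_sym S -> consistent e S ->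
  nth false target u -> e w u -> ~~ entry S.1 w u -> u \in options S w target.
Proof.
move=> te sS cS tu wu Nwu; rewrite mem_filter tu mem_iota.
rewrite (tight_bound te wu) !andbT.
by apply: contra Nwu => out; exact: barredP te sS cS out wu.
Qed.

(** The transposition of twins [u] and [v] preserves what is known and fixes [w],
    so the cases in which [w] is joined to [u] or to [v] are equivalent. *)
Definition twins (S : state) (w u v : nat) : bool :=
  (u == v) || [&& w != u, w != v,
    nth [::] S.1 u == nth [::] S.1 v & nth [::] S.2 u == nth [::] S.2 v].

Lemma consistent_twins e S u v : tight e -> state_sym S ->
  nth [::] S.1 u = nth [::] S.1 v -> nth [::] S.2 u = nth [::] S.2 v ->
  consistent e S ->
  consistent (fun i j => e (swap (u, v) i) (swap (u, v) j)) S.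
Proof.
move=> te [sE sN] rE rN [cE cN].
have eqE j : entry S.1 u j = entry S.1 v j by rewrite /entry rE.
have eqN j : entry S.2 u j = entry S.2 v j by rewrite /entry rN.
have irr := tight_irr te; have sym := tight_sym te.
split=> i j; rewrite /swap /=.
- case: (eqVneq i u) => [->|iu].
    case: (eqVneq j u) => [->|ju]; first by move=> /cE; rewrite irr.
    case: (eqVneq j v) => [->|jv]; first by rewrite eqE => /cE; rewrite irr.
    by rewrite eqE => /cE.
  case: (eqVneq i v) => [->|iv].
    case: (eqVneq j u) => [->|ju]; first by rewrite -eqE => /cE; rewrite irr.
    case: (eqVneq j v) => [->|jv]; first by move=> /cE; rewrite irr.
    by rewrite -eqE => /cE.
  case: (eqVneq j u) => [->|ju]; first by rewrite sE eqE sE => /cE.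
  case: (eqVneq j v) => [->|jv]; first by rewrite sE -eqE sE => /cE.
  exact: cE.
- case: (eqVneq i u) => [->|iu].
    case: (eqVneq j u) => [->|ju]; first by rewrite irr.
    case: (eqVneq j v) => [->|jv]; first by move=> /cN; rewrite sym.
    by rewrite eqN => /cN.
  case: (eqVneq i v) => [->|iv].
    case: (eqVneq j u) => [->|ju]; first by move=> /cN; rewrite sym.
    case: (eqVneq j v) => [->|jv]; first by rewrite irr.
    by rewrite -eqN => /cN.
  case: (eqVneq j u) => [->|ju]; first by rewrite sN eqN sN => /cN.
  case: (eqVneq j v) => [->|jv]; first by rewrite sN -eqN sN => /cN.
  exact: cN.
Qed.

Lemma refuted_twins e S w u v : tight e -> state_sym S -> consistent e S ->
  u < 30 -> refuted (link w u S) -> twins S w u v -> ~~ e w v.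
Proof.
move=> te sS cS u30 ref tw; apply/negP=> wv.
have v30 := tight_bound te wv.
case/orP: tw => [/eqP uv|/and4P[wu wv' /eqP rE /eqP rN]].
  by apply: (ref e te); apply: consistent_link => //; rewrite uv.
have te' : tight (fun i j => e (swap (u, v) i) (swap (u, v) j)).
  by apply: tight_swap => //; rewrite /in_range u30 v30.
apply: (ref _ te'); apply: consistent_link => //; last exact: consistent_twins.
by rewrite /swap /= eqxx (negPf wu) (negPf wv').
Qed.

(** The relabelling [ps] turns each known edge of [S'] into a known edge of [S],
    and each known non-edge of [S'] into a pair that is not an edge in any tight
    relation consistent with [S].  Hence [S] is at least as constrained as [S']. *)
Definition embeds (ps : seq (nat * nat)) (S' S : state) : bool :=
  let sigma := [seq shuffle ps i | i <- iota 0 30] in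
  let img := nth 0 sigma in
  [&& all in_range ps, size S'.1 <= 30, size S'.2 <= 30 &
  all (fun i =>
    let out := barred S (img i) in
    let known := nth [::] S.1 (img i) in
    all (fun j => (nth false (nth [::] S'.1 i) j ==>
                    (j < 30) && nth false known (img j)) &&
                  (nth false (nth [::] S'.2 i) j ==>
                    [&& j < 30, nth false out (img j) & ~~ nth false known (img j)]))
      (iota 0 (maxn (size (nth [::] S'.1 i)) (size (nth [::] S'.2 i)))))
    (iota 0 30)].

Lemma refuted_embeds ps S' S :
  embeds ps S' S -> state_sym S -> refuted S' -> refuted S.
Proof.
case/and4P=> rps sE sN /allP emb sS ref e te cS.
pose e' i j := e (shuffle ps i) (shuffle ps j).
have te' : tight e' by exact: tight_shuffle.
apply: (ref e' te').
have img i : i < 30 -> nth 0 [seq shuffle ps i | i <- iota 0 30] i = shuffle ps i.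
  by move=> i30; rewrite (nth_map 0) ?size_iota // nth_iota.
split=> i j ij.
- have i30 : i < 30.
    by move: ij; rewrite /entry; case: (ltnP i (size S'.1)) => [/leq_trans->//|iS];
       rewrite [nth [::] _ _]nth_default ?nth_nil.
  have js : j < size (nth [::] S'.1 i).
    by rewrite ltnNge; apply: contraTN ij => js; rewrite /entry nth_default.
  have /emb/allP/(_ j) : i \in iota 0 30 by rewrite mem_iota.
  rewrite mem_iota /= leq_max js => /(_ isT)/andP[/implyP/(_ ij)/andP[j30 kn] _].
  by apply: cS.1; rewrite /entry -!img.
have i30 : i < 30.
  by move: ij; rewrite /entry; case: (ltnP i (size S'.2)) => [/leq_trans->//|iS];
     rewrite [nth [::] _ _]nth_default ?nth_nil.
have js : j < size (nth [::] S'.2 i).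
  by rewrite ltnNge; apply: contraTN ij => js; rewrite /entry nth_default.
have /emb/allP/(_ j) : i \in iota 0 30 by rewrite mem_iota.
rewrite mem_iota /= leq_max js orbT => /(_ isT)/andP[_ /implyP/(_ ij)].
case/and3P=> j30 out; rewrite /e' -!img // => nkn.
by apply: contra nkn => eij; exact: barredP te sS cS out eij.
Qed.

(** * Case analyses as certificates *)

(** [Ask w x a cs] splits the current case according to a neighbour of [w]: one
    that lies in the union of the neighbourhoods of [x] and [a], for a known edge
    [xa] with saturated ends, or just one that is not known yet, if [x] equals
    [a].  There is one certificate in [cs] for each possible neighbour, up to
    twins.  [Same k ps] says that the current case contains a copy, under the
    relabelling [ps], of the case at position [k] among those refuted to the
    left of the path from the root, the latest one being at position 0. *)
Inductive certificate : Type :=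
| Ask of nat & nat & nat & seq certificate
| Same of nat & seq (nat * nat).

(** The vertices among which [Ask w x a] looks for a new neighbour of [w], or
    [None] when nothing ensures that there is one.  In the first case the degree
    of [w] does, in the second one the covering property of the edge [xa]. *)
Definition target (S : state) (w x a : nat) : option row :=
  let Nw := nth [::] S.1 w in
  if x == a then (if saturated Nw || (30 <= w) then None else Some (nseq 30 true))
  else
    let Nx := nth [::] S.1 x in
    let Na := nth [::] S.1 a in
    let ends := join Nx Na in
    if [&& w < 30, nth false Nx a, saturated Nx, saturated Na &
           ~~ has (fun p => p.1 && p.2) (zip Nw ends)]
    then Some ends else None.

Lemma target_hit e S w x a t : tight e -> consistent e S ->
  target S w x a = Some t ->
  exists u, [/\ nth false t u, e w u & ~~ entry S.1 w u].
Proof.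
move=> te cS; have [cE _] := cS; rewrite /target; case: ifP => _.
  case: ifP => // /negbT; rewrite negb_or -ltnNge -ltnNge => /andP[few w30] [<-].
  have : ~~ all (entry S.1 w) (filter (e w) (iota 0 30)).
    apply: contraL few; rewrite -leqNgt => /allP sub.
    rewrite -(tight_degree te w30) count_nth -!size_filter; apply: uniq_leq_size.
      by rewrite filter_uniq ?iota_uniq.
    move=> v vw; have := sub _ vw; rewrite mem_filter mem_iota => wv.
    rewrite [nth _ _ _]wv /= ltnNge; apply: contraTN wv => le.
    by rewrite /entry nth_default.
  case/allPn=> u; rewrite mem_filter mem_iota => /andP[wu /andP[_ u30]] Nwu.
  have tu : nth false (nseq 30 true) u by rewrite nth_nseq (tight_bound te wu).
  by exists u.
case: ifP => // /and5P[w30 xa satx sata disj] [<-].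
have [u wu xau] := tight_cover te (cE _ _ xa) w30.
have tu : nth false (join (nth [::] S.1 x) (nth [::] S.1 a)) u.
  rewrite nth_join; case/orP: xau => /(saturatedP te cS).
    by move=> /(_ satx); rewrite /entry => ->.
  by move=> /(_ sata); rewrite /entry => ->; rewrite orbT.
exists u; split=> //; apply: contra disj => wu'.
set r := nth [::] S.1 w in wu' *; set s := join _ _ in tu *.
have ur : u < size r.
  by rewrite ltnNge; apply: contraTN wu' => le; rewrite /entry nth_default.
have us : u < size s.
  by rewrite ltnNge; apply: contraTN tu => le; rewrite nth_default.
apply/(has_nthP (false, false)); exists u; first by rewrite size_zip leq_min ur.
by rewrite nth_zip_cond size_zip leq_min ur us /= tu andbT.
Qed.

Definition start : state := (nseq 30 [::], nseq 30 [::]).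

(** Once the case in which [w] is joined to [u] is refuted, it joins the list [K]
    and the pairs formed by [w] and the twins of [u] are known non-edges in the
    cases that follow. *)
Fixpoint refutes (K : seq state) (S : state) (c : certificate) : bool :=
  match c with
  | Same k ps => (k < size K) && embeds ps (nth start K k) S
  | Ask w x a cs =>
    if target S w x a is Some t then
      (fix go (K : seq state) (S : state) (us : seq nat) (cs : seq certificate) :=
        match cs, us with
        | [::], [::] => true
        | c :: cs', u :: us' =>
          let S' := link w u S in
          if refutes K S' c then
            go (S' :: K) (unlink w [seq v <- us | twins S w u v] S)
               [seq v <- us' | ~~ twins S w u v] cs'
          else false
        | _, _ => false
        end) K S (options S w t) cs
    else false
  end.

(** The answers to a question are tried in turn.  In each of them either the
    neighbour sought is a twin of the vertex tried, which [refuted_twins]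
    excludes, or it is among the remaining candidates and the new non-edges are
    consistent with the graph. *)
Lemma refutes_sound K S c : state_sym S ->
  (forall S', S' \in K -> refuted S') -> refutes K S c -> refuted S.
Proof.
move: c K S; fix IHc 1 => -[w x a cs|k ps] K S sS KP /=; last first.
  by case/andP=> kK emb; apply: refuted_embeds emb sS _; apply/KP/mem_nth.
case Et: (target S w x a) => [t|] // ok e te cS.
have [u [tu wu Nwu]] := target_hit te cS Et.
have : u \in options S w t by exact: mem_options te sS cS tu wu Nwu.
have : all (gtn 30) (options S w t).
  by apply/allP=> v; rewrite mem_filter mem_iota => /andP[].
move: (options S w t) ok => us.
elim: cs K S sS KP cS us {t Et tu Nwu} => [|c cs IHcs] K S sS KP cS [|v us] //.
case: ifP => // ok_c ok_cs /= /andP[v30 us30].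
have ref : refuted (link w v S).
  by apply: IHc ok_c => //; apply: link_sym.
have notw u' : twins S w v u' -> ~~ e w u'.
  by exact: refuted_twins te sS cS v30 ref.
rewrite inE => uin.
have Ntw : ~~ twins S w v u by apply: contraL wu => /notw.
have {uin} uus : u \in us.
  by case/orP: uin Ntw => // /eqP->; rewrite /twins eqxx.
apply: (IHcs _ _ _ _ _ _ ok_cs).
- exact: unlink_sym.
- by move=> S'; rewrite inE => /orP[/eqP->//|/KP].
- apply: consistent_unlink => // u'; rewrite mem_filter => /andP[tw _].
  exact: notw.
- by apply/allP=> y; rewrite mem_filter => /andP[_ /(allP us30)].
- by rewrite mem_filter Ntw.
Qed.

(** The case analysis after the breadth-first tree of vertex 0 has been fixed:
    0 is adjacent to 1, ..., 5; the vertices at distance two are 6, ..., 25, four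
    below each neighbour of 0; and 26, ..., 29 are at distance three.  The first
    20 questions ask for the neighbours of 26, ..., 29 below 1, ..., 5.  By the
    covering property of the edges at 0, each of them has exactly one neighbour
    below each neighbour of 0. *)
Definition distance_three_certificate : certificate :=
  Ask 26 0 1 [:: Ask 26 0 2 [:: Ask 26 0 3 [:: Ask 26 0 4 [:: Ask 26 0 5 [::
  Ask 27 0 1 [:: Ask 27 0 2 [:: Ask 27 0 3 [:: Ask 27 0 4 [:: Ask 27 0 5 [::
  Ask 28 0 1 [:: Ask 28 0 2 [:: Ask 28 0 3 [:: Ask 28 0 4 [:: Ask 28 0 5 [::
  Ask 29 0 1 [:: Ask 29 0 2 [:: Ask 29 0 3 [:: Ask 29 0 4 [:: Ask 29 0 5 [::
  Ask 10 10 10 [:: Ask 7 7 7 [:: Ask 7 7 7 [:: Ask 7 7 7 [:: Ask 11 1 7 [::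
  Ask 12 1 7 [:: Ask 13 1 7 [:: Ask 13 13 13 [:: Ask 13 13 13 [::
  Ask 15 15 15 [:: Ask 20 2 13 [:: Ask 20 13 29 [:: Ask 11 11 11 [::
  Ask 5 11 20 [::]]]]]]; Ask 13 13 13 [::]; Ask 13 13 13 [::]]; Same 0 [::
  (3, 4); (8, 9); (11, 12); (14, 18); (15, 20); (16, 19); (17, 21); (23, 24);
  (27, 28)]]; Ask 12 12 12 [:: Ask 12 12 12 [::]; Ask 12 12 12 [::
  Ask 15 15 15 [:: Ask 25 2 12 [:: Ask 25 12 28 [:: Ask 11 11 11 [::
  Ask 4 11 25 [::]]]]]]; Ask 12 12 12 [::]]; Ask 12 12 12 [:: Ask 12 12 12 [::
  Ask 15 2 12 [:: Ask 15 12 28 [:: Ask 19 1 7 [:: Ask 14 1 7 [:: Ask 18 1 7 [::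
  Ask 8 5 25 [:: Ask 8 8 8 [:: Ask 24 24 24 [::]]]]]]]]]; Ask 12 12 12 [::];
  Ask 12 12 12 [::]]]; Ask 11 11 11 [:: Ask 11 11 11 [::]; Ask 11 11 11 [::
  Ask 20 20 20 [:: Ask 25 2 11 [:: Ask 25 11 27 [:: Ask 14 5 25 [::
  Ask 14 25 29 [:: Ask 12 3 14 [::]]]]]]]; Ask 11 11 11 [::]]; Same 0 [::
  (4, 5); (12, 13); (16, 17); (18, 22); (19, 23); (20, 25); (21, 24);
  (28, 29)]]]; Same 0 [:: (12, 13); (16, 17); (20, 21); (24, 25); (28, 29)];
  Ask 7 7 7 [::]; Ask 7 7 7 [::]]; Same 0 [:: (11, 12); (15, 16); (19, 20);
  (23, 24); (27, 28)]; Same 0 [:: (12, 13); (16, 17); (20, 21); (24, 25);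
  (28, 29)]; Same 0 [:: (3, 4); (11, 13); (12, 13); (14, 18); (15, 21);
  (16, 19); (17, 20); (19, 20); (20, 21); (23, 25); (24, 25); (27, 29);
  (28, 29)]; Same 0 [:: (11, 12); (15, 16); (19, 20); (23, 24); (27, 28)];
  Same 0 [:: (12, 13); (16, 17); (20, 21); (24, 25); (28, 29)]; Ask 7 7 7 [::];
  Ask 7 7 7 [::]; Ask 7 7 7 [::]]; Ask 15 15 15 [:: Same 0 [:: (2, 3); (10, 15);
  (11, 14); (12, 16); (13, 17); (18, 19); (22, 23); (26, 27)]; Ask 15 15 15 [::
  Ask 10 10 10 [:: Ask 10 10 10 [:: Ask 1 10 15 [::]]; Ask 10 10 10 [::]]];
  Same 0 [:: (12, 13); (16, 17); (20, 21); (24, 25); (28, 29)];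
  Ask 15 15 15 [::]; Ask 15 15 15 [::]]; Same 0 [:: (11, 12); (15, 16);
  (19, 20); (23, 24); (27, 28)]; Same 0 [:: (12, 13); (16, 17); (20, 21);
  (24, 25); (28, 29)]; Same 0 [:: (3, 4); (11, 13); (12, 13); (14, 18);
  (15, 21); (16, 19); (17, 20); (19, 20); (20, 21); (23, 25); (24, 25);
  (27, 29); (28, 29)]; Same 0 [:: (11, 12); (15, 16); (19, 20); (23, 24);
  (27, 28)]; Same 0 [:: (12, 13); (16, 17); (20, 21); (24, 25); (28, 29)];
  Ask 10 10 10 [::]; Ask 10 10 10 [::]; Ask 10 10 10 [::]]]]]]; Ask 29 0 2 [::
  Ask 29 0 3 [:: Ask 29 0 4 [:: Ask 29 0 5 [:: Ask 6 6 6 [:: Ask 25 6 28 [::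
  Ask 25 6 27 [:: Ask 25 6 26 [:: Ask 6 5 25 [::]]]; Ask 13 13 13 [::
  Ask 13 13 13 [:: Ask 15 2 13 [:: Ask 20 2 13 [:: Ask 7 2 13 [:: Ask 7 7 7 [::
  Ask 18 2 13 [:: Ask 18 18 18 [:: Ask 23 2 13 [::]]]; Ask 19 2 13 [::];
  Ask 7 7 7 [::]; Ask 7 7 7 [::]; Ask 7 7 7 [::]]; Same 0 [:: (3, 4); (11, 12);
  (14, 18); (15, 20); (16, 19); (17, 21); (23, 24); (27, 28)]]; Ask 20 20 20 [::
  Ask 8 2 13 [:: Ask 8 8 8 [:: Ask 8 8 8 [::]; Ask 8 8 8 [::]]];
  Ask 14 20 28 [:: Ask 22 2 13 [:: Ask 14 2 13 [:: Ask 24 2 13 [::]]]];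
  Ask 23 2 13 [::]]]; Same 0 [:: (0, 6); (2, 13); (3, 27); (4, 28); (5, 26);
  (10, 25); (11, 17); (12, 21); (14, 23); (16, 19); (18, 24)]]];
  Ask 13 13 13 [::]]; Ask 25 6 26 [:: Ask 25 6 27 [:: Ask 6 5 25 [::]]]];
  Same 0 [:: (2, 3); (10, 15); (11, 14); (12, 16); (13, 17); (18, 19); (22, 23);
  (26, 27)]; Same 0 [:: (3, 4); (11, 12); (14, 18); (15, 20); (16, 19);
  (17, 21); (23, 24); (27, 28)]; Ask 25 25 25 [:: Ask 25 25 25 [::
  Ask 4 6 25 [::]; Ask 3 6 25 [::]]; Ask 25 25 25 [:: Ask 2 6 25 [::]];
  Ask 25 25 25 [::]]]]; Ask 29 0 5 [:: Same 0 [:: (4, 5); (18, 22); (19, 23);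
  (20, 24); (21, 25)]; Ask 6 6 6 [:: Ask 29 6 28 [::]; Ask 29 6 28 [::];
  Ask 21 21 21 [:: Ask 21 21 21 [:: Ask 5 6 21 [::]]; Ask 21 21 21 [::]];
  Same 0 [:: (4, 5); (18, 22); (19, 23); (20, 24); (21, 25)]]]]; Same 0 [::
  (11, 12); (15, 16); (19, 20); (23, 24); (27, 28)]; Ask 29 0 4 [:: Same 0 [::
  (3, 4); (11, 12); (14, 18); (15, 20); (16, 19); (17, 21); (23, 24); (27, 28)];
  Same 0 [:: (11, 12); (15, 16); (19, 20); (23, 24); (27, 28)]; Ask 29 0 5 [::
  Same 0 [:: (4, 5); (11, 12); (15, 16); (18, 22); (19, 24); (20, 23); (21, 25);
  (27, 28)]; Same 0 [:: (11, 12); (15, 16); (19, 20); (23, 24); (27, 28)];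
  Ask 6 6 6 [:: Ask 29 6 27 [::]; Ask 17 17 17 [:: Ask 17 17 17 [::]];
  Ask 21 21 21 [:: Ask 21 21 21 [::]]; Ask 25 25 25 [:: Ask 25 25 25 [::]]]]]];
  Same 0 [:: (10, 11); (14, 15); (18, 19); (22, 23); (26, 27)]; Same 0 [::
  (11, 12); (15, 16); (19, 20); (23, 24); (27, 28)]; Ask 29 0 3 [:: Same 0 [::
  (2, 3); (10, 16); (11, 14); (12, 15); (13, 17); (14, 15); (15, 16); (18, 20);
  (19, 20); (22, 24); (23, 24); (26, 28); (27, 28)]; Same 0 [:: (10, 11);
  (14, 15); (18, 19); (22, 23); (26, 27)]; Same 0 [:: (11, 12); (15, 16);
  (19, 20); (23, 24); (27, 28)]; Ask 29 0 4 [:: Same 0 [:: (3, 4); (10, 12);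
  (11, 12); (14, 20); (15, 18); (16, 19); (17, 21); (18, 19); (19, 20);
  (22, 24); (23, 24); (26, 28); (27, 28)]; Same 0 [:: (10, 11); (14, 15);
  (18, 19); (22, 23); (26, 27)]; Same 0 [:: (11, 12); (15, 16); (19, 20);
  (23, 24); (27, 28)]; Ask 29 0 5 [:: Same 0 [:: (4, 5); (10, 12); (11, 12);
  (14, 16); (15, 16); (18, 24); (19, 22); (20, 23); (21, 25); (22, 23);
  (23, 24); (26, 28); (27, 28)]; Same 0 [:: (10, 11); (14, 15); (18, 19);
  (22, 23); (26, 27)]; Same 0 [:: (11, 12); (15, 16); (19, 20); (23, 24);
  (27, 28)]; Ask 6 6 6 [:: Ask 13 13 13 [::]; Ask 17 17 17 [::];
  Ask 21 21 21 [::]; Ask 25 25 25 [::]]]]]]]]]]]; Ask 28 0 2 [:: Ask 28 0 3 [::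
  Ask 28 0 4 [:: Ask 28 0 5 [:: Ask 29 0 1 [:: Same 0 [:: (28, 29)];
  Ask 29 0 2 [:: Ask 29 0 3 [:: Ask 29 0 4 [:: Ask 29 0 5 [:: Ask 7 7 7 [::
  Ask 12 12 12 [:: Ask 12 12 12 [:: Ask 12 12 12 [:: Ask 14 2 12 [::
  Ask 6 2 12 [:: Ask 15 2 12 [:: Ask 7 7 7 [:: Ask 19 7 12 [:: Ask 17 17 17 [::
  Ask 17 17 17 [::]]]; Ask 22 2 12 [:: Ask 22 7 12 [::]]; Ask 19 7 12 [::
  Ask 22 22 22 [:: Ask 15 5 22 [:: Ask 25 2 12 [::]]]]]]]; Ask 14 14 14 [::
  Ask 8 2 12 [:: Ask 6 2 12 [:: Ask 23 23 23 [:: Ask 4 14 23 [::];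
  Ask 9 14 23 [:: Ask 9 2 12 [:: Ask 9 3 14 [:: Ask 9 9 9 [:: Ask 7 7 7 [::
  Ask 10 23 27 [::]]]]]]]]]; Ask 20 2 12 [:: Ask 15 2 12 [:: Ask 24 14 26 [::
  Ask 24 2 12 [:: Ask 6 2 12 [:: Ask 21 6 27 [:: Ask 11 24 28 [::]]]]]]]]]];
  Same 0 [:: (10, 11); (14, 15); (18, 19); (20, 21); (22, 23); (24, 25);
  (26, 27); (28, 29)]; Ask 12 12 12 [::]; Ask 12 12 12 [::]]; Ask 12 12 12 [::
  Ask 12 12 12 [::]]; Ask 12 12 12 [:: Ask 12 12 12 [::]]; Ask 12 12 12 [::];
  Ask 12 12 12 [::]]; Same 0 [:: (2, 3); (10, 15); (11, 14); (12, 16); (13, 17);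
  (18, 19); (22, 23); (26, 27)]; Ask 7 7 7 [:: Ask 19 7 28 [:: Ask 19 7 29 [::
  Ask 19 1 7 [:: Ask 14 19 27 [:: Same 1 [:: (1, 2); (2, 3); (6, 10); (7, 11);
  (8, 12); (9, 13); (10, 15); (11, 14); (12, 16); (13, 17); (18, 20); (19, 20);
  (22, 24); (23, 24); (26, 28); (27, 28)]]]]; Ask 19 7 29 [:: Same 0 [:: (2, 3);
  (10, 14); (11, 15); (12, 16); (13, 17); (20, 21); (24, 25); (28, 29)]]]];
  Same 0 [:: (10, 11); (14, 15); (18, 19); (20, 21); (22, 23); (24, 25);
  (26, 27); (28, 29)]; Ask 7 7 7 [::]; Ask 7 7 7 [::]]]]; Ask 29 0 4 [::
  Ask 29 0 5 [:: Ask 15 15 15 [:: Ask 8 8 8 [:: Ask 8 8 8 [:: Ask 8 8 8 [::];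
  Ask 8 8 8 [:: Ask 15 15 15 [:: Ask 29 8 15 [::]; Ask 18 18 18 [::
  Ask 2 15 18 [::]; Ask 5 15 18 [::]]; Ask 18 3 15 [:: Ask 18 8 15 [::
  Ask 15 4 18 [::]]]]; Same 0 [:: (6, 7); (10, 11); (14, 16); (19, 20);
  (22, 25); (23, 24); (26, 29); (27, 28)]]; Ask 8 8 8 [::]; Ask 8 8 8 [::]];
  Ask 8 8 8 [::]; Ask 8 8 8 [:: Ask 8 8 8 [::]; Ask 8 8 8 [::]]; Ask 8 8 8 [::];
  Ask 8 8 8 [::]]; Same 0 [:: (1, 2); (6, 11); (7, 10); (8, 12); (9, 13);
  (14, 16); (22, 25); (26, 29)]; Ask 15 15 15 [::]; Ask 15 15 15 [::
  Ask 18 3 15 [:: Ask 18 15 27 [:: Ask 15 18 29 [::]]]; Ask 18 3 15 [::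
  Ask 18 15 27 [:: Ask 15 18 26 [::]]]]; Ask 15 15 15 [::]; Ask 15 15 15 [::]]];
  Ask 29 0 5 [:: Same 0 [:: (4, 5); (18, 22); (19, 23); (20, 24); (21, 25)];
  Ask 15 15 15 [:: Ask 8 8 8 [:: Ask 8 8 8 [:: Ask 8 8 8 [:: Ask 10 1 8 [::
  Ask 11 1 8 [:: Ask 11 11 11 [:: Ask 17 1 8 [:: Ask 18 18 18 [:: Ask 7 4 18 [::
  Ask 9 4 18 [:: Ask 9 9 9 [:: Ask 24 1 9 [::]]]]]]; Ask 24 1 8 [::]]];
  Ask 10 10 10 [:: Ask 17 1 8 [:: Ask 25 25 25 [:: Ask 6 5 25 [::
  Ask 20 8 25 [:: Ask 20 25 29 [:: Ask 16 1 8 [:: Ask 12 6 27 [::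
  Ask 12 6 26 [:: Ask 6 2 12 [::]]]]]]]]]; Ask 19 1 8 [:: Ask 11 1 8 [::
  Ask 25 25 25 [:: Ask 11 11 11 [:: Ask 18 18 18 [::]]]]]]]]; Same 0 [:: (6, 7);
  (10, 11); (14, 16); (18, 21); (19, 20); (22, 25); (23, 24); (26, 29);
  (27, 28)]; Ask 8 8 8 [::]; Ask 8 8 8 [::]]; Ask 8 8 8 [:: Ask 8 8 8 [::]];
  Ask 8 8 8 [:: Ask 8 8 8 [::]]; Ask 8 8 8 [::]; Ask 8 8 8 [::]]; Same 0 [::
  (1, 2); (6, 11); (7, 10); (8, 12); (9, 13); (14, 16); (18, 21); (22, 25);
  (26, 29)]; Ask 15 15 15 [:: Ask 21 15 27 [:: Ask 21 3 15 [:: Ask 21 15 28 [::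
  Ask 6 6 6 [:: Ask 25 6 26 [:: Ask 12 12 12 [:: Ask 12 12 12 [::]]]]]];
  Ask 21 15 28 [:: Same 0 [:: (1, 2); (6, 10); (7, 11); (8, 12); (9, 13);
  (19, 20); (23, 24); (27, 28)]]]]; Same 0 [:: (6, 7); (10, 11); (14, 16);
  (18, 21); (19, 20); (22, 25); (23, 24); (26, 29); (27, 28)];
  Ask 15 15 15 [::]; Ask 15 15 15 [::]]]]]; Ask 29 0 3 [:: Same 0 [:: (2, 3);
  (10, 15); (11, 14); (12, 16); (13, 17); (18, 19); (22, 23); (26, 27)];
  Ask 29 0 4 [:: Ask 29 0 5 [:: Ask 10 10 10 [:: Ask 10 10 10 [::
  Ask 23 2 10 [:: Ask 8 8 8 [:: Ask 8 8 8 [:: Ask 19 8 10 [:: Ask 19 1 8 [::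
  Ask 9 10 28 [:: Ask 9 10 26 [:: Ask 15 1 8 [:: Ask 16 16 16 [:: Ask 6 3 16 [::
  Ask 18 1 8 [:: Ask 24 3 16 [:: Ask 24 16 29 [:: Ask 9 2 10 [:: Ask 15 1 9 [::
  Ask 12 3 15 [:: Ask 12 12 12 [:: Ask 3 6 12 [::]]]]]]]]]]]]]]; Ask 18 1 8 [::
  Ask 16 16 16 [:: Ask 16 16 16 [::]]]]]; Ask 8 8 8 [::]]; Ask 23 10 26 [::
  Ask 8 23 29 [::]]]; Ask 23 2 10 [:: Ask 8 8 8 [:: Ask 8 8 8 [::]];
  Ask 23 10 26 [:: Ask 10 5 23 [::]; Ask 8 5 23 [:: Ask 8 23 27 [::
  Ask 8 8 8 [:: Ask 23 1 8 [::]]]]]; Ask 17 17 17 [:: Ask 17 17 17 [::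
  Ask 23 23 23 [:: Ask 8 5 23 [:: Ask 8 23 27 [:: Ask 8 8 8 [::
  Ask 20 1 8 [::]]]]]]; Ask 17 17 17 [::]]]; Same 1 [:: (3, 4); (6, 7);
  (11, 12); (14, 20); (15, 18); (16, 19); (17, 21); (22, 24); (26, 28);
  (27, 29)]; Same 1 [:: (3, 4); (6, 7); (11, 12); (14, 20); (15, 18); (16, 19);
  (17, 21); (22, 24); (26, 28); (27, 29)]; Ask 23 23 23 [:: Ask 3 10 23 [::];
  Ask 4 10 23 [::]; Ask 3 10 23 [::]]; Ask 23 2 10 [:: Ask 8 8 8 [::
  Ask 8 8 8 [:: Ask 15 1 8 [:: Ask 16 10 28 [:: Ask 16 1 8 [:: Ask 20 1 8 [::]];
  Ask 16 8 10 [:: Ask 16 10 26 [:: Ask 10 3 16 [::]]]; Ask 18 1 8 [::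
  Ask 19 10 26 [:: Ask 14 1 8 [:: Ask 19 1 8 [::]]; Ask 19 8 10 [::
  Ask 19 10 28 [:: Ask 10 4 19 [::]]]; Ask 25 25 25 [:: Ask 9 9 9 [::
  Ask 14 9 25 [:: Ask 20 9 25 [:: Ask 13 13 13 [:: Ask 14 5 25 [::
  Ask 24 1 9 [::]]]]]]]]; Ask 19 8 10 [:: Ask 25 25 25 [:: Ask 17 5 25 [::
  Ask 18 5 25 [::]]]]]]; Ask 16 8 10 [:: Ask 25 25 25 [:: Ask 25 25 25 [::
  Ask 15 5 25 [:: Ask 21 5 25 [::]]]; Ask 25 25 25 [::]]]]]; Ask 8 8 8 [::]];
  Ask 23 10 26 [:: Ask 8 5 23 [::]]]]; Ask 16 16 16 [:: Ask 10 10 10 [::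
  Ask 23 2 10 [:: Ask 23 10 26 [:: Ask 10 5 23 [::]]]; Ask 16 16 16 [::
  Ask 5 10 16 [::]; Ask 27 10 16 [::]]; Ask 23 2 10 [:: Ask 23 10 26 [::
  Ask 10 23 27 [::]]]]; Ask 16 16 16 [:: Ask 10 10 10 [:: Ask 1 10 16 [::]]];
  Ask 16 16 16 [:: Ask 10 10 10 [:: Ask 1 10 16 [::]]]; Ask 16 16 16 [::]];
  Ask 17 17 17 [:: Ask 17 17 17 [:: Ask 17 17 17 [:: Ask 10 10 10 [::
  Ask 29 10 17 [::]; Ask 23 23 23 [:: Ask 4 10 23 [::]; Ask 1 10 23 [::]]]];
  Ask 10 10 10 [:: Same 1 [:: (3, 4); (6, 7); (11, 12); (14, 20); (15, 18);
  (16, 19); (17, 21); (22, 24); (26, 28); (27, 29)]; Ask 23 23 23 [::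
  Ask 4 10 23 [::]]; Ask 17 17 17 [:: Ask 19 10 28 [:: Ask 7 3 17 [::
  Ask 19 3 17 [::]]; Ask 19 10 17 [:: Ask 19 10 26 [:: Ask 10 4 19 [::]]];
  Ask 25 25 25 [:: Ask 25 25 25 [:: Ask 7 5 25 [:: Ask 7 3 17 [::
  Ask 19 7 28 [::]]]]; Ask 25 25 25 [::]]]]]; Ask 17 17 17 [::];
  Ask 17 17 17 [::]]; Ask 17 17 17 [:: Ask 17 17 17 [::]]; Ask 17 17 17 [::
  Ask 17 17 17 [::]; Ask 17 17 17 [::]]; Ask 17 17 17 [::]; Ask 17 17 17 [::]];
  Ask 10 10 10 [:: Ask 23 2 10 [:: Ask 23 10 26 [:: Ask 10 23 29 [::]]]];
  Same 1 [:: (3, 4); (6, 7); (11, 12); (14, 20); (15, 18); (16, 19); (17, 21);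
  (22, 24); (26, 28); (27, 29)]; Ask 10 10 10 [::]; Ask 10 10 10 [::]];
  Ask 15 15 15 [:: Ask 15 15 15 [:: Ask 18 3 15 [:: Ask 8 8 8 [::
  Ask 8 8 8 [::]]; Ask 18 15 28 [:: Ask 15 4 18 [::]]]; Ask 29 15 27 [::];
  Ask 18 18 18 [:: Ask 2 15 18 [::]; Ask 5 15 18 [::]]; Ask 29 15 27 [::];
  Ask 29 15 27 [::]; Ask 18 3 15 [:: Ask 8 8 8 [:: Ask 8 8 8 [::]];
  Ask 18 15 28 [:: Ask 15 4 18 [::]]]]; Ask 15 15 15 [:: Ask 18 3 15 [::
  Ask 18 15 28 [:: Ask 15 18 26 [::]]]; Ask 18 3 15 [:: Ask 18 15 28 [::
  Ask 15 4 18 [::]]]]; Ask 15 15 15 [:: Ask 18 18 18 [:: Ask 5 15 18 [::]];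
  Ask 29 15 27 [::]; Ask 29 15 27 [::]; Ask 25 25 25 [:: Ask 25 25 25 [::
  Ask 26 15 25 [::]]; Ask 25 25 25 [::]]]; Ask 15 15 15 [::]; Ask 15 15 15 [::
  Ask 29 15 27 [::]; Ask 18 3 15 [:: Ask 18 15 28 [:: Ask 15 18 26 [::]]]];
  Ask 15 15 15 [::]; Ask 15 15 15 [::]]]; Same 0 [:: (2, 3); (10, 15); (11, 14);
  (12, 16); (13, 17); (18, 19); (22, 23); (26, 27)]; Ask 29 0 5 [:: Same 0 [::
  (2, 3); (4, 5); (10, 15); (11, 14); (12, 16); (13, 17); (18, 23); (19, 22);
  (20, 24); (21, 25); (26, 27)]; Same 0 [:: (2, 3); (10, 15); (11, 14);
  (12, 16); (13, 17); (18, 19); (22, 23); (26, 27)]; Ask 6 6 6 [::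
  Ask 12 12 12 [:: Ask 6 6 6 [:: Ask 12 12 12 [:: Ask 15 2 12 [:: Ask 16 1 6 [::
  Ask 21 1 6 [:: Ask 25 1 6 [:: Ask 20 20 20 [::]]]; Ask 20 20 20 [::]]]];
  Same 0 [:: (4, 5); (18, 22); (19, 23); (20, 24); (21, 25)]];
  Ask 12 12 12 [::]; Ask 12 12 12 [::]]; Ask 13 13 13 [:: Ask 13 13 13 [::
  Ask 13 13 13 [::]; Ask 13 13 13 [::]]; Ask 6 6 6 [:: Same 1 [:: (2, 3);
  (10, 15); (11, 14); (12, 16); (13, 17); (18, 19); (22, 23); (26, 27)];
  Ask 29 6 26 [::]; Ask 21 21 21 [:: Ask 21 21 21 [::]]; Ask 29 6 26 [::];
  Ask 25 25 25 [:: Ask 25 25 25 [::]]]; Ask 13 13 13 [:: Ask 13 13 13 [::]];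
  Ask 13 13 13 [:: Ask 13 13 13 [::]]; Ask 13 13 13 [::]; Ask 13 13 13 [::]];
  Same 1 [:: (2, 3); (10, 15); (11, 14); (12, 16); (13, 17); (18, 19); (22, 23);
  (26, 27)]; Same 1 [:: (2, 3); (10, 15); (11, 14); (12, 16); (13, 17);
  (18, 19); (22, 23); (26, 27)]; Ask 6 6 6 [:: Ask 12 1 6 [:: Ask 21 1 6 [::
  Ask 16 1 6 [:: Ask 20 20 20 [:: Ask 12 6 20 [::]]]]; Ask 20 20 20 [::
  Ask 16 6 20 [::]]]]; Ask 6 6 6 [:: Same 0 [:: (4, 5); (18, 22); (19, 23);
  (20, 24); (21, 25)]]; Ask 6 6 6 [::]; Ask 6 6 6 [::]]]]]]; Ask 29 0 2 [::
  Same 1 [:: (1, 2); (6, 10); (7, 11); (8, 12); (9, 13); (19, 20); (23, 24);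
  (27, 28)]; Same 1 [:: (1, 2); (6, 10); (7, 11); (8, 12); (9, 13); (19, 20);
  (23, 24); (27, 28)]; Ask 29 0 3 [:: Same 0 [:: (2, 3); (10, 15); (11, 14);
  (12, 16); (13, 17); (18, 19); (22, 23); (26, 27)]; Same 2 [:: (2, 3);
  (10, 15); (11, 14); (12, 16); (13, 17); (18, 19); (22, 23); (26, 27)];
  Ask 29 0 4 [:: Ask 29 0 5 [:: Ask 10 10 10 [:: Ask 8 8 8 [:: Ask 10 10 10 [::
  Ask 23 2 10 [:: Ask 23 10 26 [:: Ask 10 5 23 [::]]]; Ask 8 8 8 [::
  Ask 5 8 10 [::]; Ask 27 8 10 [::]]; Ask 23 2 10 [:: Ask 23 10 26 [::
  Ask 10 23 27 [::]]]]; Ask 8 8 8 [:: Ask 10 10 10 [:: Ask 23 10 26 [::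
  Ask 23 2 10 [:: Ask 10 5 23 [::]]; Ask 15 1 8 [:: Ask 17 17 17 [::
  Ask 17 17 17 [::]]; Ask 15 15 15 [:: Ask 18 3 15 [::]; Ask 29 15 28 [::];
  Ask 12 3 15 [:: Ask 12 15 27 [::]]; Ask 18 3 15 [::]]]]; Ask 3 8 10 [::]]];
  Ask 8 8 8 [:: Ask 10 10 10 [:: Ask 27 8 10 [::]; Ask 3 8 10 [::]]];
  Ask 8 8 8 [::]]; Ask 15 15 15 [:: Same 0 [:: (2, 3); (4, 5); (10, 15);
  (11, 14); (12, 16); (13, 17); (18, 23); (19, 22); (20, 24); (21, 25);
  (26, 27)]; Ask 12 12 12 [:: Ask 12 12 12 [:: Ask 15 15 15 [::
  Ask 1 12 15 [::]]; Ask 15 15 15 [:: Ask 1 12 15 [::]]]; Ask 12 12 12 [::];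
  Ask 12 12 12 [::]]; Ask 15 15 15 [:: Ask 18 18 18 [:: Ask 1 15 18 [::]];
  Ask 29 15 28 [::]; Ask 29 15 28 [::]; Ask 29 15 28 [::]]; Ask 15 15 15 [::
  Ask 18 18 18 [:: Ask 1 15 18 [::]]]; Ask 15 15 15 [:: Ask 29 15 28 [::];
  Ask 29 15 28 [::]]; Ask 15 15 15 [::]; Ask 15 15 15 [::]]; Ask 16 16 16 [::
  Ask 10 10 10 [:: Ask 23 2 10 [:: Ask 23 10 26 [:: Ask 10 5 23 [::]]];
  Ask 16 16 16 [:: Ask 5 10 16 [::]; Ask 27 10 16 [::]]; Ask 23 2 10 [::
  Ask 23 10 26 [:: Ask 10 23 27 [::]]]]; Ask 16 16 16 [:: Ask 10 10 10 [::
  Ask 1 10 16 [::]]]; Ask 16 16 16 [:: Ask 10 10 10 [:: Ask 1 10 16 [::]]];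
  Ask 16 16 16 [::]]; Ask 10 10 10 [:: Ask 29 10 28 [::]; Ask 29 10 28 [::];
  Ask 23 23 23 [:: Ask 4 10 23 [::]; Ask 1 10 23 [::]]; Ask 29 10 28 [::]];
  Ask 10 10 10 [:: Ask 29 10 28 [::]]; Ask 10 10 10 [:: Ask 23 23 23 [::
  Ask 3 10 23 [::]; Ask 1 10 23 [::]]; Ask 29 10 28 [::]]; Ask 10 10 10 [::];
  Ask 10 10 10 [::]]; Same 0 [:: (1, 2); (6, 10); (7, 11); (8, 12); (9, 13);
  (19, 20); (23, 24); (27, 28)]; Ask 18 18 18 [:: Ask 18 18 18 [::
  Ask 15 4 18 [:: Ask 15 18 26 [:: Ask 15 18 29 [::]]]; Ask 27 18 29 [::];
  Ask 27 18 29 [::]; Ask 15 4 18 [:: Ask 15 18 26 [:: Ask 15 18 29 [::]]]];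
  Ask 18 18 18 [:: Ask 28 18 29 [::]; Ask 27 18 29 [::]; Ask 15 15 15 [::
  Ask 5 15 18 [::]]; Ask 27 18 29 [::]; Ask 28 18 29 [::]; Ask 27 18 29 [::]];
  Same 1 [:: (1, 2); (6, 10); (7, 11); (8, 12); (9, 13); (19, 20); (23, 24);
  (27, 28)]; Same 1 [:: (1, 2); (6, 10); (7, 11); (8, 12); (9, 13); (19, 20);
  (23, 24); (27, 28)]; Ask 18 18 18 [::]; Ask 18 18 18 [:: Ask 28 18 29 [::];
  Ask 27 18 29 [::]]; Ask 18 18 18 [::]; Ask 18 18 18 [::]]]; Same 0 [:: (2, 3);
  (10, 15); (11, 14); (12, 16); (13, 17); (18, 19); (22, 23); (26, 27)];
  Same 0 [:: (1, 2); (6, 10); (7, 11); (8, 12); (9, 13); (19, 20); (23, 24);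
  (27, 28)]; Ask 29 0 5 [:: Same 0 [:: (1, 3); (4, 5); (6, 15); (7, 14);
  (8, 16); (9, 17); (18, 24); (19, 23); (20, 22); (21, 25); (26, 28)];
  Same 0 [:: (2, 3); (10, 15); (11, 14); (12, 16); (13, 17); (18, 19); (22, 23);
  (26, 27)]; Same 0 [:: (1, 2); (6, 10); (7, 11); (8, 12); (9, 13); (19, 20);
  (23, 24); (27, 28)]; Ask 6 6 6 [:: Ask 12 12 12 [:: Ask 6 6 6 [::
  Ask 12 12 12 [:: Ask 15 2 12 [:: Ask 20 20 20 [:: Ask 20 20 20 [::];
  Ask 20 20 20 [::]]]]; Same 0 [:: (4, 5); (18, 22); (19, 23); (20, 24);
  (21, 25)]]; Ask 12 12 12 [::]; Ask 12 12 12 [::]]; Ask 13 13 13 [::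
  Ask 13 13 13 [:: Ask 13 13 13 [::]; Ask 13 13 13 [::]]; Ask 6 6 6 [::
  Same 1 [:: (2, 3); (10, 15); (11, 14); (12, 16); (13, 17); (18, 19); (22, 23);
  (26, 27)]; Ask 29 6 26 [::]; Ask 21 21 21 [:: Ask 21 21 21 [::]];
  Ask 29 6 26 [::]; Ask 25 25 25 [:: Ask 25 25 25 [::]]]; Ask 13 13 13 [::
  Ask 13 13 13 [::]]; Ask 13 13 13 [:: Ask 13 13 13 [::]]; Ask 13 13 13 [::];
  Ask 13 13 13 [::]]; Same 1 [:: (2, 3); (10, 15); (11, 14); (12, 16); (13, 17);
  (18, 19); (22, 23); (26, 27)]; Same 1 [:: (2, 3); (10, 15); (11, 14);
  (12, 16); (13, 17); (18, 19); (22, 23); (26, 27)]; Ask 6 6 6 [::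
  Ask 25 25 25 [:: Ask 25 25 25 [:: Ask 28 25 29 [::]]; Ask 25 25 25 [::]]];
  Ask 6 6 6 [:: Same 0 [:: (4, 5); (18, 22); (19, 23); (20, 24); (21, 25)]];
  Ask 6 6 6 [::]; Ask 6 6 6 [::]]]]]]]]]; Ask 28 0 4 [:: Same 0 [:: (3, 4);
  (14, 18); (15, 19); (16, 20); (17, 21)]; Ask 28 0 5 [:: Same 0 [:: (4, 5);
  (18, 22); (19, 23); (20, 24); (21, 25)]; Ask 29 0 1 [:: Same 3 [:: (28, 29)];
  Ask 29 0 2 [:: Ask 29 0 3 [:: Same 3 [:: (10, 11); (14, 15); (18, 19);
  (22, 23); (26, 27); (28, 29)]; Ask 29 0 4 [:: Same 0 [:: (3, 4); (14, 18);
  (15, 19); (16, 20); (17, 21)]; Ask 29 0 5 [:: Same 0 [:: (4, 5); (18, 22);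
  (19, 23); (20, 24); (21, 25)]; Ask 7 7 7 [:: Ask 7 7 7 [:: Ask 27 7 28 [::];
  Ask 26 7 29 [::]; Ask 27 7 28 [::]; Ask 26 7 29 [::]; Ask 27 7 28 [::];
  Ask 26 7 29 [::]]; Ask 7 7 7 [:: Ask 14 14 14 [:: Ask 14 14 14 [::
  Ask 13 7 14 [:: Ask 13 14 26 [:: Ask 19 19 19 [::]]; Ask 19 19 19 [::
  Ask 19 19 19 [::]]]]; Ask 14 14 14 [::]]; Same 0 [:: (4, 5); (18, 22);
  (19, 23); (20, 24); (21, 25)]]; Same 0 [:: (10, 11); (14, 15); (16, 17);
  (18, 19); (20, 21); (22, 23); (24, 25); (26, 27); (28, 29)]; Same 0 [::
  (3, 4); (10, 11); (14, 19); (15, 18); (16, 21); (17, 20); (22, 23); (24, 25);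
  (26, 27); (28, 29)]; Same 0 [:: (10, 11); (14, 15); (16, 17); (18, 19);
  (20, 21); (22, 23); (24, 25); (26, 27); (28, 29)]; Ask 7 7 7 [::];
  Ask 7 7 7 [::]]]]]; Ask 29 0 3 [:: Same 4 [:: (1, 2); (6, 11); (7, 10);
  (8, 12); (9, 13); (10, 11); (11, 12); (14, 15); (15, 16); (18, 19); (19, 20);
  (22, 23); (23, 24); (26, 27); (27, 29); (28, 29)]; Ask 29 0 4 [:: Same 0 [::
  (3, 4); (14, 18); (15, 19); (16, 20); (17, 21)]; Ask 29 0 5 [:: Same 0 [::
  (4, 5); (18, 22); (19, 23); (20, 24); (21, 25)]; Ask 10 10 10 [::
  Ask 10 10 10 [:: Ask 15 15 15 [:: Ask 4 10 15 [::]]; Ask 27 10 28 [::];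
  Ask 29 10 26 [::]; Ask 27 10 28 [::]; Ask 29 10 26 [::]; Ask 27 10 28 [::]];
  Ask 10 10 10 [::]; Ask 10 10 10 [:: Ask 29 10 26 [::]; Ask 27 10 28 [::];
  Ask 29 10 26 [::]; Ask 27 10 28 [::]]; Ask 10 10 10 [:: Ask 15 2 10 [::
  Ask 15 10 26 [:: Ask 10 3 15 [::]; Ask 10 3 15 [::]]]]; Same 0 [:: (6, 7);
  (11, 12); (14, 16); (18, 20); (19, 21); (22, 24); (23, 25); (26, 28);
  (27, 29)]; Ask 10 10 10 [::]; Ask 10 10 10 [::]]]]; Ask 29 0 4 [:: Same 1 [::
  (3, 4); (14, 18); (15, 19); (16, 20); (17, 21)]; Same 1 [:: (3, 4); (14, 18);
  (15, 19); (16, 20); (17, 21)]; Ask 29 0 5 [:: Same 1 [:: (4, 5); (18, 22);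
  (19, 23); (20, 24); (21, 25)]; Same 1 [:: (4, 5); (18, 22); (19, 23);
  (20, 24); (21, 25)]; Ask 6 6 6 [:: Ask 12 12 12 [:: Ask 12 12 12 [::];
  Ask 12 12 12 [::]; Ask 12 12 12 [::]]; Ask 6 6 6 [:: Ask 29 6 26 [::];
  Ask 28 6 27 [::]; Ask 29 6 26 [::]; Ask 28 6 27 [::]; Ask 29 6 26 [::];
  Ask 28 6 27 [::]]; Ask 6 6 6 [:: Ask 12 1 6 [:: Ask 17 1 6 [:: Ask 25 1 6 [::
  Ask 16 16 16 [:: Ask 12 6 16 [::]]]]; Ask 16 16 16 [::]]; Same 0 [:: (4, 5);
  (18, 22); (19, 23); (20, 24); (21, 25)]]; Ask 6 6 6 [:: Same 0 [:: (3, 4);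
  (14, 18); (15, 19); (16, 20); (17, 21)]; Same 0 [:: (4, 5); (18, 22);
  (19, 23); (20, 24); (21, 25)]]; Ask 6 6 6 [:: Same 0 [:: (3, 5); (14, 22);
  (15, 23); (16, 24); (17, 25)]]; Ask 6 6 6 [:: Same 0 [:: (4, 5); (18, 22);
  (19, 23); (20, 24); (21, 25)]]; Ask 6 6 6 [::]; Ask 6 6 6 [::]]]]]];
  Ask 29 0 2 [:: Same 1 [:: (1, 2); (6, 10); (7, 11); (8, 12); (9, 13);
  (15, 16); (19, 20); (23, 24); (27, 28)]; Same 1 [:: (1, 2); (6, 10); (7, 11);
  (8, 12); (9, 13); (15, 16); (19, 20); (23, 24); (27, 28)]; Ask 29 0 3 [::
  Ask 29 0 4 [:: Same 5 [:: (2, 3); (7, 8); (10, 14); (11, 15); (12, 16);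
  (13, 17); (28, 29)]; Same 0 [:: (1, 2); (6, 10); (7, 11); (8, 12); (9, 13);
  (15, 16); (19, 20); (23, 24); (27, 28)]; Ask 29 0 5 [:: Same 0 [:: (1, 2);
  (4, 5); (6, 10); (7, 11); (8, 12); (9, 13); (15, 16); (18, 22); (19, 24);
  (20, 23); (21, 25); (27, 28)]; Same 0 [:: (1, 2); (6, 10); (7, 11); (8, 12);
  (9, 13); (15, 16); (19, 20); (23, 24); (27, 28)]; Ask 6 6 6 [::
  Ask 12 12 12 [:: Ask 12 12 12 [::]; Ask 6 6 6 [:: Ask 12 12 12 [::
  Ask 5 6 12 [::]; Ask 4 6 12 [::]]; Ask 12 12 12 [:: Ask 16 6 12 [::]];
  Ask 12 12 12 [:: Ask 16 6 12 [::]]]; Ask 12 12 12 [::]; Ask 12 12 12 [::]];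
  Ask 6 6 6 [:: Ask 29 6 27 [::]; Ask 28 6 27 [::]; Ask 29 6 27 [::];
  Ask 28 6 27 [::]; Ask 29 6 27 [::]; Ask 28 6 27 [::]]; Same 1 [:: (2, 3);
  (7, 8); (10, 14); (11, 15); (12, 16); (13, 17); (20, 21); (24, 25); (28, 29)];
  Same 1 [:: (2, 3); (7, 8); (10, 14); (11, 15); (12, 16); (13, 17); (20, 21);
  (24, 25); (28, 29)]; Ask 6 6 6 [:: Ask 20 20 20 [:: Ask 20 20 20 [::
  Ask 14 4 20 [:: Ask 14 20 28 [:: Ask 21 1 6 [:: Ask 24 6 26 [::
  Ask 19 19 19 [:: Ask 19 19 19 [::]]]]; Ask 7 3 14 [:: Ask 7 14 29 [::
  Ask 7 14 26 [:: Ask 14 1 7 [::]]]; Ask 19 19 19 [:: Ask 7 7 7 [::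
  Ask 7 7 7 [::]]]]]]]; Ask 20 20 20 [:: Ask 29 20 28 [::]];
  Ask 20 20 20 [::]]]; Ask 6 6 6 [:: Same 0 [:: (4, 5); (18, 22); (19, 23);
  (20, 24); (21, 25)]]; Ask 6 6 6 [::]; Ask 6 6 6 [::]]]]; Ask 29 0 4 [::
  Same 0 [:: (3, 4); (14, 18); (15, 19); (16, 20); (17, 21)]; Ask 29 0 5 [::
  Same 0 [:: (4, 5); (18, 22); (19, 23); (20, 24); (21, 25)]; Ask 6 6 6 [::
  Ask 6 6 6 [:: Ask 20 1 6 [:: Ask 20 6 26 [:: Ask 6 4 20 [::];
  Ask 6 4 20 [::]]]; Ask 28 6 27 [::]; Ask 28 6 27 [::]; Ask 20 1 6 [::
  Ask 20 6 26 [:: Ask 6 4 20 [::]; Ask 6 4 20 [::]]]]; Ask 6 6 6 [::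
  Ask 29 6 26 [::]; Ask 28 6 27 [::]; Ask 20 20 20 [:: Ask 5 6 20 [::]];
  Ask 28 6 27 [::]; Ask 29 6 26 [::]; Ask 28 6 27 [::]]; Same 1 [:: (2, 3);
  (7, 8); (10, 15); (11, 14); (12, 16); (13, 17); (18, 19); (22, 23); (24, 25);
  (26, 27); (28, 29)]; Same 1 [:: (2, 3); (7, 8); (10, 15); (11, 14); (12, 16);
  (13, 17); (18, 19); (22, 23); (24, 25); (26, 27); (28, 29)]; Ask 6 6 6 [::];
  Ask 6 6 6 [:: Ask 29 6 26 [::]; Ask 28 6 27 [::]]; Ask 6 6 6 [::];
  Ask 6 6 6 [::]]]; Ask 29 0 5 [:: Same 1 [:: (4, 5); (18, 22); (19, 23);
  (20, 24); (21, 25)]; Same 1 [:: (4, 5); (18, 22); (19, 23); (20, 24);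
  (21, 25)]; Ask 6 6 6 [:: Ask 12 12 12 [:: Ask 12 12 12 [::]; Ask 6 6 6 [::
  Ask 12 12 12 [:: Ask 5 6 12 [::]; Ask 4 6 12 [::]]; Ask 12 12 12 [::
  Ask 16 6 12 [::]]; Ask 12 12 12 [:: Ask 16 6 12 [::]]]; Ask 12 12 12 [::];
  Ask 12 12 12 [::]]; Ask 6 6 6 [:: Ask 29 6 26 [::]; Ask 28 6 27 [::];
  Ask 29 6 26 [::]; Ask 28 6 27 [::]; Ask 29 6 26 [::]; Ask 28 6 27 [::]];
  Same 1 [:: (2, 3); (7, 8); (10, 15); (11, 14); (12, 16); (13, 17); (18, 19);
  (20, 21); (22, 23); (24, 25); (26, 27); (28, 29)]; Same 1 [:: (2, 3); (7, 8);
  (10, 15); (11, 14); (12, 16); (13, 17); (18, 19); (20, 21); (22, 23);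
  (24, 25); (26, 27); (28, 29)]; Ask 6 6 6 [:: Ask 20 20 20 [:: Ask 20 20 20 [::
  Ask 15 4 20 [:: Ask 15 20 28 [:: Ask 10 3 15 [::]; Ask 10 3 15 [::]]]];
  Ask 20 20 20 [:: Ask 29 20 28 [::]]; Ask 20 20 20 [::]]]; Ask 6 6 6 [::
  Same 0 [:: (4, 5); (18, 22); (19, 23); (20, 24); (21, 25)]]; Ask 6 6 6 [::];
  Ask 6 6 6 [::]]]]; Same 0 [:: (1, 2); (6, 10); (7, 11); (8, 12); (9, 13);
  (15, 16); (19, 20); (23, 24); (27, 28)]; Ask 29 0 4 [:: Same 2 [:: (3, 4);
  (14, 18); (15, 19); (16, 20); (17, 21)]; Same 1 [:: (1, 2); (3, 4); (6, 10);
  (7, 11); (8, 12); (9, 13); (14, 18); (15, 20); (16, 19); (17, 21); (23, 24);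
  (27, 28)]; Same 0 [:: (1, 2); (6, 10); (7, 11); (8, 12); (9, 13); (15, 16);
  (19, 20); (23, 24); (27, 28)]; Ask 29 0 5 [:: Same 2 [:: (4, 5); (18, 22);
  (19, 23); (20, 24); (21, 25)]; Same 1 [:: (1, 2); (4, 5); (6, 10); (7, 11);
  (8, 12); (9, 13); (15, 16); (18, 22); (19, 24); (20, 23); (21, 25); (27, 28)];
  Same 0 [:: (1, 2); (6, 10); (7, 11); (8, 12); (9, 13); (15, 16); (19, 20);
  (23, 24); (27, 28)]; Ask 6 6 6 [:: Ask 12 12 12 [:: Ask 12 12 12 [::];
  Ask 12 12 12 [::]; Ask 12 12 12 [::]]; Ask 6 6 6 [:: Ask 29 6 26 [::];
  Ask 28 6 27 [::]; Ask 29 6 26 [::]; Ask 28 6 27 [::]; Ask 29 6 26 [::];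
  Ask 28 6 27 [::]]; Ask 16 16 16 [:: Ask 16 16 16 [::]; Ask 6 6 6 [::
  Ask 16 16 16 [:: Ask 12 6 16 [::]]; Ask 16 16 16 [:: Ask 12 6 16 [::]]];
  Ask 16 16 16 [::]; Ask 16 16 16 [::]]; Ask 6 6 6 [:: Same 0 [:: (3, 4);
  (14, 18); (15, 19); (16, 20); (17, 21)]; Same 0 [:: (4, 5); (18, 22);
  (19, 23); (20, 24); (21, 25)]]; Ask 6 6 6 [:: Same 0 [:: (3, 5); (14, 22);
  (15, 23); (16, 24); (17, 25)]]; Ask 6 6 6 [:: Same 0 [:: (4, 5); (18, 22);
  (19, 23); (20, 24); (21, 25)]]; Ask 6 6 6 [::]; Ask 6 6 6 [::]]]]]]]]]];
  Same 0 [:: (10, 11); (14, 15); (18, 19); (22, 23); (26, 27)]; Ask 28 0 3 [::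
  Same 0 [:: (2, 3); (10, 15); (11, 14); (12, 16); (13, 17); (18, 19); (22, 23);
  (26, 27)]; Same 0 [:: (10, 11); (14, 15); (18, 19); (22, 23); (26, 27)];
  Ask 28 0 4 [:: Same 0 [:: (3, 4); (10, 11); (14, 19); (15, 18); (16, 20);
  (17, 21); (22, 23); (26, 27)]; Same 0 [:: (10, 11); (14, 15); (18, 19);
  (22, 23); (26, 27)]; Ask 28 0 5 [:: Same 0 [:: (4, 5); (10, 11); (14, 15);
  (18, 23); (19, 22); (20, 24); (21, 25); (26, 27)]; Same 0 [:: (10, 11);
  (14, 15); (18, 19); (22, 23); (26, 27)]; Ask 29 0 1 [:: Same 8 [:: (28, 29)];
  Ask 29 0 2 [:: Same 7 [:: (10, 11); (14, 15); (18, 19); (22, 23); (26, 27);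
  (28, 29)]; Same 0 [:: (10, 11); (14, 15); (18, 19); (22, 23); (26, 27)];
  Ask 29 0 3 [:: Same 0 [:: (2, 3); (10, 15); (11, 14); (12, 16); (13, 17);
  (18, 19); (22, 23); (26, 27)]; Same 0 [:: (10, 11); (14, 15); (18, 19);
  (22, 23); (26, 27)]; Ask 29 0 4 [:: Same 0 [:: (3, 4); (10, 11); (14, 19);
  (15, 18); (16, 20); (17, 21); (22, 23); (26, 27)]; Same 0 [:: (10, 11);
  (14, 15); (18, 19); (22, 23); (26, 27)]; Ask 29 0 5 [:: Same 0 [:: (4, 5);
  (10, 11); (14, 15); (18, 23); (19, 22); (20, 24); (21, 25); (26, 27)];
  Same 0 [:: (10, 11); (14, 15); (18, 19); (22, 23); (26, 27)]; Ask 6 6 6 [::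
  Ask 12 12 12 [:: Ask 12 12 12 [::]; Ask 12 12 12 [::]; Ask 12 12 12 [::]];
  Same 0 [:: (12, 13); (16, 17); (20, 21); (24, 25); (28, 29)]; Same 0 [::
  (2, 3); (10, 14); (11, 15); (12, 17); (13, 16); (20, 21); (24, 25); (28, 29)];
  Same 0 [:: (12, 13); (16, 17); (20, 21); (24, 25); (28, 29)]; Same 0 [::
  (3, 4); (12, 13); (14, 18); (15, 19); (16, 21); (17, 20); (24, 25); (28, 29)];
  Same 0 [:: (12, 13); (16, 17); (20, 21); (24, 25); (28, 29)]; Ask 6 6 6 [::];
  Ask 6 6 6 [::]]]]]]; Ask 29 0 2 [:: Same 8 [:: (7, 8); (10, 11); (14, 15);
  (18, 19); (22, 23); (26, 27); (28, 29)]; Same 0 [:: (10, 11); (14, 15);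
  (18, 19); (22, 23); (26, 27)]; Ask 29 0 3 [:: Same 0 [:: (2, 3); (10, 15);
  (11, 14); (12, 16); (13, 17); (18, 19); (22, 23); (26, 27)]; Same 0 [::
  (10, 11); (14, 15); (18, 19); (22, 23); (26, 27)]; Ask 29 0 4 [:: Same 0 [::
  (3, 4); (10, 11); (14, 19); (15, 18); (16, 20); (17, 21); (22, 23); (26, 27)];
  Same 0 [:: (10, 11); (14, 15); (18, 19); (22, 23); (26, 27)]; Ask 29 0 5 [::
  Same 0 [:: (4, 5); (10, 11); (14, 15); (18, 23); (19, 22); (20, 24); (21, 25);
  (26, 27)]; Same 0 [:: (10, 11); (14, 15); (18, 19); (22, 23); (26, 27)];
  Ask 6 6 6 [:: Ask 6 6 6 [::]; Ask 6 6 6 [:: Ask 29 6 26 [::];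
  Ask 28 6 26 [::]; Ask 29 6 26 [::]; Ask 28 6 26 [::]; Ask 29 6 26 [::];
  Ask 28 6 26 [::]]; Ask 6 6 6 [:: Ask 12 1 6 [:: Ask 20 1 6 [:: Ask 24 1 6 [::
  Ask 21 21 21 [:: Ask 16 16 16 [:: Ask 16 16 16 [::]]]]]]; Ask 12 1 6 [::
  Ask 17 1 6 [:: Ask 21 1 6 [:: Ask 16 16 16 [:: Ask 24 1 6 [:: Ask 20 1 6 [::
  Ask 25 25 25 [::]]]]]]]]; Same 0 [:: (7, 8); (16, 17); (20, 21); (24, 25);
  (28, 29)]; Ask 6 6 6 [:: Ask 12 1 6 [:: Ask 21 1 6 [:: Ask 17 1 6 [::
  Ask 20 20 20 [:: Ask 24 1 6 [:: Ask 16 1 6 [:: Ask 25 25 25 [::]]]]]]]];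
  Ask 6 6 6 [:: Ask 12 1 6 [:: Ask 20 1 6 [:: Ask 16 1 6 [:: Ask 21 21 21 [::
  Ask 24 24 24 [:: Ask 24 24 24 [::]]]]]]]; Ask 6 6 6 [::]; Ask 6 6 6 [::]]]]];
  Ask 29 0 3 [:: Same 1 [:: (2, 3); (10, 15); (11, 14); (12, 16); (13, 17);
  (18, 19); (22, 23); (26, 27)]; Same 0 [:: (10, 11); (14, 15); (18, 19);
  (22, 23); (26, 27)]; Same 2 [:: (2, 3); (10, 14); (11, 15); (12, 16);
  (13, 17)]; Ask 29 0 4 [:: Same 1 [:: (3, 4); (10, 11); (14, 19); (15, 18);
  (16, 20); (17, 21); (22, 23); (26, 27)]; Same 0 [:: (10, 11); (14, 15);
  (18, 19); (22, 23); (26, 27)]; Same 2 [:: (3, 4); (14, 18); (15, 19);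
  (16, 20); (17, 21)]; Ask 29 0 5 [:: Same 1 [:: (4, 5); (10, 11); (14, 15);
  (18, 23); (19, 22); (20, 24); (21, 25); (26, 27)]; Same 0 [:: (10, 11);
  (14, 15); (18, 19); (22, 23); (26, 27)]; Same 2 [:: (4, 5); (18, 22);
  (19, 23); (20, 24); (21, 25)]; Ask 6 6 6 [:: Ask 12 12 12 [::
  Ask 12 12 12 [::]; Ask 12 12 12 [::]; Ask 12 12 12 [::]]; Same 0 [:: (7, 8);
  (12, 13); (16, 17); (20, 21); (24, 25); (28, 29)]; Same 0 [:: (2, 3); (7, 8);
  (10, 14); (11, 15); (12, 17); (13, 16); (20, 21); (24, 25); (28, 29)];
  Same 0 [:: (7, 8); (12, 13); (16, 17); (20, 21); (24, 25); (28, 29)];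
  Same 0 [:: (3, 4); (7, 8); (12, 13); (14, 18); (15, 19); (16, 21); (17, 20);
  (24, 25); (28, 29)]; Same 0 [:: (7, 8); (12, 13); (16, 17); (20, 21);
  (24, 25); (28, 29)]; Ask 6 6 6 [::]; Ask 6 6 6 [::]]]]]]]]]]]]]]]];
  Ask 27 0 2 [:: Same 0 [:: (1, 2); (6, 10); (7, 11); (8, 12); (9, 13)];
  Ask 27 0 3 [:: Same 0 [:: (2, 3); (10, 14); (11, 15); (12, 16); (13, 17)];
  Ask 27 0 4 [:: Same 0 [:: (3, 4); (14, 18); (15, 19); (16, 20); (17, 21)];
  Ask 27 0 5 [:: Same 0 [:: (4, 5); (18, 22); (19, 23); (20, 24); (21, 25)];
  Ask 28 0 1 [:: Same 4 [:: (27, 28)]; Same 0 [:: (6, 7); (10, 11); (14, 15);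
  (18, 19); (22, 23); (26, 27)]; Ask 28 0 2 [:: Same 0 [:: (1, 2); (6, 11);
  (7, 10); (8, 12); (9, 13); (14, 15); (18, 19); (22, 23); (26, 27)]; Same 0 [::
  (6, 7); (10, 11); (14, 15); (18, 19); (22, 23); (26, 27)]; Ask 28 0 3 [::
  Same 0 [:: (2, 3); (6, 7); (10, 15); (11, 14); (12, 16); (13, 17); (18, 19);
  (22, 23); (26, 27)]; Same 0 [:: (6, 7); (10, 11); (14, 15); (18, 19);
  (22, 23); (26, 27)]; Ask 28 0 4 [:: Same 0 [:: (3, 4); (6, 7); (10, 11);
  (14, 19); (15, 18); (16, 20); (17, 21); (22, 23); (26, 27)]; Same 0 [::
  (6, 7); (10, 11); (14, 15); (18, 19); (22, 23); (26, 27)]; Ask 28 0 5 [::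
  Same 0 [:: (4, 5); (6, 7); (10, 11); (14, 15); (18, 23); (19, 22); (20, 24);
  (21, 25); (26, 27)]; Same 0 [:: (6, 7); (10, 11); (14, 15); (18, 19);
  (22, 23); (26, 27)]; Ask 29 0 1 [:: Same 8 [:: (6, 7); (10, 11); (14, 15);
  (18, 19); (22, 23); (26, 27); (28, 29)]; Same 0 [:: (6, 7); (10, 11);
  (14, 15); (18, 19); (22, 23); (26, 27)]; Same 0 [:: (7, 8); (11, 12);
  (15, 16); (19, 20); (23, 24); (27, 28)]; Ask 29 0 2 [:: Same 0 [:: (1, 2);
  (6, 12); (7, 10); (8, 11); (9, 13); (10, 11); (11, 12); (14, 16); (15, 16);
  (18, 20); (19, 20); (22, 24); (23, 24); (26, 28); (27, 28)]; Same 0 [::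
  (6, 7); (10, 11); (14, 15); (18, 19); (22, 23); (26, 27)]; Same 0 [:: (7, 8);
  (11, 12); (15, 16); (19, 20); (23, 24); (27, 28)]; Ask 29 0 3 [:: Same 0 [::
  (2, 3); (6, 8); (7, 8); (10, 16); (11, 14); (12, 15); (13, 17); (14, 15);
  (15, 16); (18, 20); (19, 20); (22, 24); (23, 24); (26, 28); (27, 28)];
  Same 0 [:: (6, 7); (10, 11); (14, 15); (18, 19); (22, 23); (26, 27)];
  Same 0 [:: (7, 8); (11, 12); (15, 16); (19, 20); (23, 24); (27, 28)];
  Ask 29 0 4 [:: Same 0 [:: (3, 4); (6, 8); (7, 8); (10, 12); (11, 12);
  (14, 20); (15, 18); (16, 19); (17, 21); (18, 19); (19, 20); (22, 24);
  (23, 24); (26, 28); (27, 28)]; Same 0 [:: (6, 7); (10, 11); (14, 15);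
  (18, 19); (22, 23); (26, 27)]; Same 0 [:: (7, 8); (11, 12); (15, 16);
  (19, 20); (23, 24); (27, 28)]; Ask 29 0 5 [:: Same 0 [:: (4, 5); (6, 8);
  (7, 8); (10, 12); (11, 12); (14, 16); (15, 16); (18, 24); (19, 22); (20, 23);
  (21, 25); (22, 23); (23, 24); (26, 28); (27, 28)]; Same 0 [:: (6, 7);
  (10, 11); (14, 15); (18, 19); (22, 23); (26, 27)]; Same 0 [:: (7, 8);
  (11, 12); (15, 16); (19, 20); (23, 24); (27, 28)]; Ask 7 7 7 [::
  Ask 10 10 10 [:: Ask 10 10 10 [:: Ask 7 7 7 [:: Ask 7 7 7 [:: Ask 5 7 10 [::];
  Ask 20 7 10 [:: Ask 17 17 17 [:: Ask 12 7 17 [:: Ask 22 22 22 [::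
  Ask 8 17 22 [:: Ask 8 2 10 [:: Ask 19 2 10 [::]]]]]]]]; Ask 7 7 7 [::
  Ask 17 7 10 [:: Ask 17 2 10 [:: Ask 20 20 20 [:: Ask 13 7 20 [::
  Ask 13 1 7 [:: Ask 14 4 20 [:: Ask 6 4 20 [:: Ask 22 22 22 [:: Ask 8 3 17 [::
  Ask 13 7 27 [::]]]]]]]]]]]; Ask 7 7 7 [::]; Ask 7 7 7 [::]]; Same 0 [::
  (4, 5); (18, 22); (19, 23); (20, 24); (21, 25)]]; Same 0 [:: (8, 9); (12, 13);
  (16, 17); (20, 21); (24, 25); (28, 29)]; Same 0 [:: (3, 4); (8, 9); (12, 13);
  (14, 18); (15, 19); (16, 21); (17, 20); (24, 25); (28, 29)]; Same 0 [::
  (8, 9); (12, 13); (16, 17); (20, 21); (24, 25); (28, 29)]; Ask 10 10 10 [::];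
  Ask 10 10 10 [::]]; Same 0 [:: (6, 8); (10, 12); (14, 16); (18, 20); (22, 24);
  (26, 28)]; Same 0 [:: (8, 9); (12, 13); (16, 17); (20, 21); (24, 25);
  (28, 29)]; Same 0 [:: (2, 3); (6, 9); (8, 9); (10, 17); (11, 15); (12, 14);
  (13, 16); (14, 16); (16, 17); (18, 21); (20, 21); (22, 25); (24, 25);
  (26, 29); (28, 29)]; Same 0 [:: (6, 8); (10, 12); (14, 16); (18, 20);
  (22, 24); (26, 28)]; Same 0 [:: (8, 9); (12, 13); (16, 17); (20, 21);
  (24, 25); (28, 29)]; Same 0 [:: (3, 4); (6, 9); (8, 9); (10, 13); (12, 13);
  (14, 21); (15, 19); (16, 18); (17, 20); (18, 20); (20, 21); (22, 25);
  (24, 25); (26, 29); (28, 29)]; Same 0 [:: (6, 8); (10, 12); (14, 16);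
  (18, 20); (22, 24); (26, 28)]; Same 0 [:: (8, 9); (12, 13); (16, 17);
  (20, 21); (24, 25); (28, 29)]; Ask 7 7 7 [::]; Ask 7 7 7 [::];
  Ask 7 7 7 [::]]]]]]]]]]]]]]]]]]]]]].

(** Asking five times for a new neighbour of 0 and then four times for one of each
    of 1, ..., 5 builds the breadth-first tree.  All the vertices without known
    edges are twins, so each of these questions has one answer. *)
Definition tree_questions : seq nat :=
  nseq 5 0 ++ flatten [seq nseq 4 w | w <- iota 1 5].

Definition full_certificate : certificate :=
  foldr (fun w c => Ask w w w [:: c]) distance_three_certificate tree_questions.

Lemma full_certificate_ok : refutes [::] start full_certificate.
Proof. by vm_compute. Qed.

Theorem no_tight_relation e : ~ tight e.
Proof.
have blank i j : entry (nseq 30 [::]) i j = false.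
  by rewrite /entry nth_nseq if_same nth_nil.
have sym_start : state_sym start by split=> u v; rewrite !blank.
move=> te.
apply: (refutes_sound (K := [::]) sym_start _ full_certificate_ok te) => //.
by split=> u v; rewrite blank.
Qed.

(** * The order is at least 32 *)

Lemma regular_handshake (T : finType) (e : rel T) k :
  simple_graph e -> regular e k -> ~~ odd (#|T| * k).
Proof.
move=> [sym irr] reg.
have -> : #|T| * k = \sum_(x : T) \sum_(y : T) e x y.
  rewrite -sum_nat_const; apply: eq_bigr => x _.
  rewrite -(reg x) cardsE -sum1_card big_mkcond; apply: eq_bigr => y _.
  by rewrite [x in if x then _ else _]unfold_in; case: (e x y).
(* Each edge is counted once in each direction. *)
pose lower := \sum_(x : T) \sum_(y : T | enum_rank x < enum_rank y) e x y.
have -> : \sum_(x : T) \sum_(y : T) e x y = lower + lower.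
  have lowerE :
      lower = \sum_(x : T) \sum_(y : T | enum_rank y < enum_rank x) e x y.
    rewrite /lower (exchange_big_dep predT) //=; apply: eq_bigr => x _.
    by apply: eq_bigr => y _; rewrite sym.
  rewrite {2}lowerE -big_split /=; apply: eq_bigr => x _.
  rewrite (bigID (fun y => enum_rank x < enum_rank y)) /=; congr (_ + _).
  rewrite (bigD1 x) ?ltnn //= irr add0n; apply: eq_bigl => y.
  by rewrite -leqNgt ltn_neqAle andbC (inj_eq val_inj) (inj_eq enum_rank_inj).
by rewrite addnn odd_double.
Qed.

Section NoSmallGraph.

Variables (T : finType) (e : rel T) (w : nat).
Hypothesis G : egr e w 5 5 12.

(** By inclusion-exclusion the union has 21 + 21 - 12 elements. *)
Lemma egr_order_from_edge x y : e x y ->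
  #|two_walks e x :|: two_walks e y| = 30.
Proof.
move=> xy; have [sim _ reg gir lam] := G.
have tri := girth5_triangle_free sim gir; have sqr := girth5_square_free sim gir.
have := cardsUI (two_walks e x) (two_walks e y).
rewrite -(five_cycles_through_edge sim tri sqr xy) lam //.
have := card_two_walks x sim sqr reg isT.
have := card_two_walks y sim sqr reg isT.
lia.
Qed.

Lemma egr_order_ge30 : 30 <= w.
Proof.
have [sim card reg [[[|x s] //] _ _ _] lam] := G.
have : 0 < #|[set y | e x y]| by rewrite reg.
case/card_gt0P=> y; rewrite inE => xy.
by rewrite -(egr_order_from_edge xy) -card max_card.
Qed.

Lemma egr_order_neq31 : w != 31.
Proof.
have [sim card reg _ _] := G; apply/eqP=> w31.
by have := regular_handshake sim reg; rewrite card w31.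
Qed.

Lemma egr_order30_tight : w = 30 -> exists r : rel nat, tight r.
Proof.
move=> w30; have [sim card reg gir lam] := G; have [sym irr] := sim.
have tri := girth5_triangle_free sim gir; have sqr := girth5_square_free sim gir.
have cT : #|T| = 30 by rewrite card.
have x0 : T by apply: (enum_val (A := T) (cast_ord (esym cT) ord0)).
pose f := nth x0 (enum T).
have sT : size (enum T) = 30 by rewrite -cardE.
have fK z : exists2 i, i < 30 & f i = z.
  have zT : z \in enum T by rewrite mem_enum.
  by exists (index z (enum T)); rewrite ?/f ?nth_index // -sT index_mem.
have finj i j : i < 30 -> j < 30 -> f i = f j -> i = j.
  by move=> i30 j30 /eqP; rewrite nth_uniq ?sT ?enum_uniq // => /eqP.
exists (fun i j => [&& i < 30, j < 30 & e (f i) (f j)]); split.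
- by move=> i j; rewrite sym andbCA.
- by move=> i; rewrite irr !andbF.
- by move=> i j /and3P[].
- move=> i i30; transitivity (count (e (f i)) (enum T)).
    rewrite -(mkseq_nth x0 (enum T)) count_map sT.
    by apply: eq_in_count => j; rewrite mem_iota i30 => /andP[_ /= ->].
  rewrite -(reg (f i)) cardE -size_filter enumT; congr size.
  by apply: eq_filter => y; rewrite /= inE.
- move=> i j k /and3P[i30 j30 ij] /and3P[_ k30 jk].
  by rewrite (negPf (tri _ _ _ ij jk)) !andbF.
- move=> i j a b /and3P[i30 a30 ia] /and3P[_ j30 aj] /and3P[_ b30 ib].
  case/and3P=> _ _ bj.
  by case: (sqr _ _ _ _ ia aj ib bj) => /finj; [left; auto | right; auto].
move=> x a z /and3P[x30 a30 xa] z30.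
(* The union has 30 elements, so it contains all the vertices. *)
have : f z \in two_walks e (f x) :|: two_walks e (f a).
  suff -> : two_walks e (f x) :|: two_walks e (f a) = setT by rewrite inE.
  by apply/eqP; rewrite eqEcard subsetT cardsT cT egr_order_from_edge.
rewrite inE; case/orP=> /two_walksP[u ux uz]; have [i i30 iu] := fK u;
  exists i; by rewrite ?x30 ?a30 ?z30 i30 iu ?ux ?orbT // sym uz.
Qed.

Theorem egr_order_ge32 : 32 <= w.
Proof.
have := egr_order_ge30; have := egr_order_neq31.
have w30 : w != 30.
  by apply/eqP=> /egr_order30_tight[r /no_tight_relation].
lia.
Qed.

End NoSmallGraph.

(** * Recognizing an edge-girth-regular graph on a table *)

(** A positive number of 5-cycles through some edge provides the cycle of length
    five that [has_girth] requires. *)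
Lemma egr5_intro (T : finType) (e : rel T) k lambda :
  simple_graph e -> regular e k -> triangle_free e -> square_free e ->
  0 < lambda -> (exists x y, e x y) ->
  (forall x y, e x y -> #|two_walks e x :&: two_walks e y| = lambda) ->
  egr e #|T| k 5 lambda.
Proof.
move=> sim reg tri sqr l0 [x [y xy]] walks.
have lam u v : e u v ->
    #|[set C in cycles_of_length e 5 | [set u; v] \in C]| = lambda.
  by move=> uv; rewrite five_cycles_through_edge // walks.
split=> //; apply: girth5_intro => //.
have : 0 < #|[set C in cycles_of_length e 5 | [set x; y] \in C]| by rewrite lam.
case/card_gt0P=> C; rewrite inE => /andP[/imsetP[t]]; rewrite inE => gt _ _.
by exists t; rewrite ?size_tuple.
Qed.

Definition tabulate (n : nat) (r : rel nat) : table :=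
  mkseq (fun i => mkseq (r i) n) n.

Lemma entry_tabulate n r i j : i < n -> j < n -> entry (tabulate n r) i j = r i j.
Proof. by move=> ni nj; rewrite /entry nth_mkseq // nth_mkseq. Qed.

(** The hypotheses of [egr5_intro] for the graph with adjacency table [m], in
    terms of a table [walks] for the walks of length two. *)
Definition egr_table (n k lambda : nat) (m : table) : bool :=
  let V := iota 0 n in
  let walk i z := has (fun a => entry m i a && entry m a z) V in
  let walks := tabulate n walk in
  [&& all (fun i => ~~ entry m i i) V,
      all (fun i => all (fun j => entry m i j == entry m j i) V) V,
      all (fun i => count (entry m i) V == k) V,
      all (fun i => all (fun j => entry m i j ==> ~~ entry walks i j) V) V,
      all (fun i => all (fun a => entry m i a ==>
        all (fun b => (entry m i b && (a != b)) ==>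
          all (fun j => (entry m a j && entry m b j) ==> (i == j)) V) V) V) V,
      has (fun i => has (entry m i) V) V &
      all (fun i => all (fun j => entry m i j ==>
        (count (fun z => entry walks i z && entry walks j z) V == lambda)) V) V].

Lemma all_iotaP n (p : pred nat) :
  reflect (forall i, i < n -> p i) (all p (iota 0 n)).
Proof.
by apply: (iffP allP) => H i; move: (H i); rewrite mem_iota.
Qed.

Lemma card_ord_count n (p : pred nat) :
  #|[set i : 'I_n | p i]| = count p (iota 0 n).
Proof.
rewrite cardE -val_enum_ord count_map -size_filter enumT.
by congr size; apply: eq_filter => i; rewrite /= inE.
Qed.

Lemma egr_of_table (T : finType) (e : rel T) n k lambda m (f : 'I_n -> T) :
  injective f -> #|T| = n -> (forall i j, e (f i) (f j) = entry m i j) ->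
  0 < lambda -> egr_table n k lambda m -> egr e n k 5 lambda.
Proof.
move=> finj cT fE l0 /and5P[/all_iotaP irr /all_iotaP sym /all_iotaP reg
  /all_iotaP tri /and3P[/all_iotaP sqr edge /all_iotaP lam]].
have fbij : bijective f by apply: inj_card_bij; rewrite ?cT ?card_ord.
have fS x : exists i, f i = x by case: fbij => g _ gK; exists (g x).
pose h : rel 'I_n := fun i j => entry m i j.
have walkE (i z : 'I_n) :
    (z \in two_walks h i) = has (fun a => entry m i a && entry m a z) (iota 0 n).
  apply/two_walksP/hasP=> [[a ia az]|[a]].
    by exists (val a); rewrite ?mem_iota //= /h in ia az *; rewrite ia az.
  by rewrite mem_iota => /= an /andP[ia az]; exists (Ordinal an).
have walks_image i : two_walks e (f i) = f @: two_walks h i.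
  apply/setP=> x; have [z <-] := fS x; rewrite mem_imset //.
  apply/two_walksP/two_walksP=> [[y]|[a ia az]].
    by have [a <-] := fS y; rewrite !fE; exists a.
  by exists (f a); rewrite fE.
rewrite -{1}cT; apply: egr5_intro => //.
- split=> [x y|x]; have [i <-] := fS x; rewrite ?fE; last exact/negbTE/irr.
  have [j <-] := fS y; rewrite !fE.
  by have /all_iotaP/(_ j (ltn_ord j))/eqP := sym i (ltn_ord i).
- move=> x; have [i <-] := fS x.
  have -> : [set y | e (f i) y] = f @: [set j | h i j].
    apply/setP=> y; have [j <-] := fS y.
    by rewrite mem_imset // !inE fE.
  by rewrite card_imset // card_ord_count; apply/eqP/reg.
- move=> x y z; have [i <-] := fS x; have [j <-] := fS y; have [l <-] := fS z.
  rewrite !fE => ij jl.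
  have /all_iotaP/(_ l (ltn_ord l))/implyP := tri i (ltn_ord i).
  rewrite entry_tabulate // -walkE => noil; apply/negP=> /noil/negP[].
  by apply/two_walksP; exists j.
- move=> x y u v; have [i <-] := fS x; have [j <-] := fS y.
  have [a <-] := fS u; have [b <-] := fS v; rewrite !fE => ia aj ib bj.
  have [->|ab] := eqVneq a b; [by right|left; congr f; apply: val_inj; apply/eqP].
  have /all_iotaP/(_ a (ltn_ord a))/implyP/(_ ia) := sqr i (ltn_ord i).
  move=> /all_iotaP/(_ b (ltn_ord b)); rewrite ib (ab : (a : nat) != b) /=.
  by move=> /all_iotaP/(_ j (ltn_ord j)); rewrite aj bj.
- case/hasP: edge => i; rewrite mem_iota => /= ni /hasP[j].
  rewrite mem_iota => /= nj ij.
  by exists (f (Ordinal ni)), (f (Ordinal nj)); rewrite fE.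
- move=> x y; have [i <-] := fS x; have [j <-] := fS y; rewrite fE => ij.
  rewrite !walks_image -imsetI; last by move=> ? ? _ _; apply: finj.
  rewrite card_imset //; have /all_iotaP/(_ j (ltn_ord j)) := lam i (ltn_ord i).
  rewrite ij => /eqP <-; rewrite -card_ord_count; apply: eq_card => z.
  by rewrite in_setI !walkE [RHS]inE !entry_tabulate.
Qed.

(** * The graph H *)

(** The elements 0, 1, alpha, alpha^2 of the field are encoded by 0, 1, 2, 3, and
    [(s, (p, q))] is the point with coordinates [p] and [q] if [s] is false, and
    the line with these coordinates if [s] is true. *)
Definition codes : seq (bool * (nat * nat)) :=
  [seq (s, pq) | s <- [:: false; true],
                 pq <- [seq (p, q) | p <- iota 0 4, q <- iota 0 4]].

Definition code (i : nat) : bool * (nat * nat) := nth (false, (0, 0)) codes i.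

Definition add4 (p q : nat) : nat :=
  nth 0 (nth [::] [:: [:: 0; 1; 2; 3]; [:: 1; 0; 3; 2];
                      [:: 2; 3; 0; 1]; [:: 3; 2; 1; 0]] p) q.

Definition mul4 (p q : nat) : nat :=
  nth 0 (nth [::] [:: [:: 0; 0; 0; 0]; [:: 0; 1; 2; 3];
                      [:: 0; 2; 3; 1]; [:: 0; 3; 1; 2]] p) q.

(** As 0 + 1 = 1 and alpha + 1 = alpha^2, two points on a vertical line are
    joined when their ordinates differ by 1; likewise two lines with the same
    slope are joined when their intercepts differ by alpha, which has code 2. *)
Definition H_code (c d : bool * (nat * nat)) : bool :=
  let: (s, (p, q)) := c in let: (s', (p', q')) := d in
  match s, s' with
  | false, true => q == add4 (mul4 p' p) q'
  | true, false => q' == add4 (mul4 p p') q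
  | false, false => (p == p') && (q' == add4 q 1)
  | true, true => (p == p') && (q' == add4 q 2)
  end.

Definition H_table : table := tabulate 32 (fun i j => H_code (code i) (code j)).

Lemma H_table_egr : egr_table 32 5 12 H_table.
Proof. by vm_compute. Qed.

Section FieldWithFourElements.

Variables (F : finFieldType) (alpha : F).
Hypotheses (F4 : #|F| = 4) (alpha2 : (alpha ^+ 2 = alpha + 1)%R).

Local Open Scope ring_scope.

Definition F4_elements : seq F := [:: 0; 1; alpha; alpha ^+ 2].

Definition F4_el (p : nat) : F := F4_elements`_p.

Lemma F4_alpha_neq0 : alpha != 0.
Proof.
apply/eqP=> a0; move: alpha2; rewrite a0 expr2 mul0r add0r => /esym/eqP.
by rewrite oner_eq0.
Qed.

(** Squaring alpha^2 = alpha + 1 and using alpha^4 = alpha gives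
    2 * (alpha + 1) = 0, where alpha + 1 = alpha^2 is nonzero. *)
Lemma F4_char2 : 1 + 1 = 0 :> F.
Proof.
have a4 : alpha ^+ 4 = alpha by rewrite -{1}F4 expf_card.
have : (1 + 1) * (alpha + 1) = 0.
  have : alpha ^+ 4 = (alpha + 1) ^+ 2 by rewrite -alpha2 -exprM.
  rewrite a4 => E; have := alpha2; move: E; clear => E1 E2.
  have -> : (1 + 1) * (alpha + 1) = (alpha + 1) ^+ 2 - alpha ^+ 2 + 1 by ring.
  rewrite -E1 E2; ring.
move/eqP; rewrite mulf_eq0 -alpha2 expf_eq0 /= (negPf F4_alpha_neq0) orbF.
by move/eqP.
Qed.

Lemma F4_uniq : uniq F4_elements.
Proof.
have a0 := F4_alpha_neq0; have n10 := oner_neq0 F.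
have a1 : alpha != 1.
  apply/eqP=> a1; move: alpha2; rewrite a1 expr1n F4_char2 => /eqP.
  by rewrite (negPf n10).
have a2n0 : alpha + 1 != 0 by rewrite -alpha2 expf_neq0.
rewrite /= !inE !negb_or alpha2 eq_sym n10 eq_sym a0 eq_sym a2n0 /=.
rewrite eq_sym a1 -[X in X != _]add0r (inj_eq (addIr _)) eq_sym a0 /=.
by rewrite -[X in X == _]addr0 (inj_eq (addrI _)) eq_sym n10.
Qed.

Lemma F4_enum x : exists2 p, (p < 4)%N & F4_el p = x.
Proof.
have sub : {subset F4_elements <= enum F} by move=> y; rewrite mem_enum.
have [|_ eqF] := uniq_min_size F4_uniq sub; first by rewrite -cardE F4.
have : x \in F4_elements by rewrite eqF mem_enum.
by move=> xF; exists (index x F4_elements); rewrite ?index_mem // /F4_el nth_index.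
Qed.

Lemma F4_el_eq p q : (p < 4)%N -> (q < 4)%N -> (F4_el p == F4_el q) = (p == q).
Proof. by move=> p4 q4; rewrite /F4_el nth_uniq ?F4_uniq. Qed.

Lemma F4_double (x : F) : x + x = 0.
Proof. by rewrite -[x]mul1r -mulrDl F4_char2 mul0r. Qed.

Lemma F4_add p q : (p < 4)%N -> (q < 4)%N ->
  F4_el (add4 p q) = F4_el p + F4_el q.
Proof.
have dbl := F4_double.
move: p q => [|[|[|[|//]]]] [|[|[|[|//]]]] _ _;
  rewrite /F4_el /= ?alpha2 ?addr0 ?add0r ?dbl //.
- by rewrite addrC.
- by rewrite addrCA dbl addr0.
- by rewrite addrA dbl add0r.
- by rewrite -addrA dbl addr0.
- by rewrite addrAC dbl add0r.
Qed.

Lemma F4_mul p q : (p < 4)%N -> (q < 4)%N ->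
  F4_el (mul4 p q) = F4_el p * F4_el q.
Proof.
have a3 : alpha ^+ 3 = 1.
  by rewrite exprS alpha2 mulrDr mulr1 -expr2 alpha2 addrAC F4_double add0r.
move: p q => [|[|[|[|//]]]] [|[|[|[|//]]]] _ _;
  rewrite /F4_el /= ?mulr0 ?mul0r ?mulr1 ?mul1r -?exprS -?exprSr -?exprD ?a3 //.
by rewrite exprSr a3 mul1r.
Qed.

Lemma set2_eq (T : finType) (a b c d : T) : a != b ->
  ([set c; d] == [set a; b]) = (c == a) && (d == b) || (c == b) && (d == a).
Proof.
move=> ab; apply/eqP/idP=> [E|/orP[]/andP[/eqP-> /eqP->//]]; last by rewrite setUC.
have [] : a \in [set c; d] /\ b \in [set c; d] by rewrite E !inE !eqxx orbT.
rewrite !inE => /orP[]/eqP aE /orP[]/eqP bE; subst; rewrite ?eqxx ?orbT // in ab *.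
Qed.

Definition H_vertex (c : bool * (nat * nat)) : vertex F :=
  let: (s, (p, q)) := c in
  (if s then inr else inl) (F4_el p, F4_el q).

Lemma mem_codes c : (c \in codes) = (c.2.1 < 4)%N && (c.2.2 < 4)%N.
Proof.
by case: c => -[] [[|[|[|[|p]]]] [|[|[|[|q]]]]]; rewrite //= andbF.
Qed.

Lemma H_vertexE c d : c \in codes -> d \in codes ->
  H_rel alpha (H_vertex c) (H_vertex d) = H_code c d.
Proof.
rewrite !mem_codes.
have [n01 nab n0a n1b] :
    [/\ 0 != 1 :> F, alpha != alpha ^+ 2, 0 != alpha & 1 != alpha ^+ 2].
  have := F4_uniq; rewrite /= !inE !negb_or.
  by case/and4P=> /and3P[-> -> _] /andP[_ ->] ->.
case: c d => [s [p q]] [s' [p' q']] /= /andP[p4 q4] /andP[p'4 q'4].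
have el4 := F4_el_eq.
have add_lt a b : (add4 a b < 4)%N.
  by move: a b => [|[|[|[|a]]]] [|[|[|[|b]]]];
    rewrite /add4 //= ?nth_nil ?nth_default.
have mul_lt a b : (mul4 a b < 4)%N.
  by move: a b => [|[|[|[|a]]]] [|[|[|[|b]]]];
    rewrite /mul4 //= ?nth_nil ?nth_default.
rewrite /H_rel; case: s; case: s' => /=; rewrite ?orbF.
- rewrite el4 //; case: eqP => //= _; rewrite !inE !set2_eq //.
  rewrite -[0%R]/(F4_el 0) -[1%R]/(F4_el 1) -[(alpha ^+ 2)%R]/(F4_el 3).
  rewrite -[alpha]/(F4_el 2) !el4 //.
  by move: q q' q4 q'4 => [|[|[|[|//]]]] [|[|[|[|//]]]].
- by rewrite /incident /= -F4_mul // -F4_add // el4.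
- by rewrite /incident /= -F4_mul // -F4_add // el4.
- rewrite el4 //; case: eqP => //= _; rewrite !inE !set2_eq //.
  rewrite -[0%R]/(F4_el 0) -[1%R]/(F4_el 1) -[(alpha ^+ 2)%R]/(F4_el 3).
  rewrite -[alpha]/(F4_el 2) !el4 //.
  by move: q q' q4 q'4 => [|[|[|[|//]]]] [|[|[|[|//]]]].
Qed.

Theorem H_egr : egr (H_rel alpha) 32 5 5 12.
Proof.
have size_codes : size codes = 32 by [].
have codes_uniq : uniq codes by [].
pose f (i : 'I_32) := H_vertex (code i).
have code_in (i : 'I_32) : code i \in codes by rewrite mem_nth.
apply: (egr_of_table (f := f) _ _ _ _ H_table_egr) => //.
- move=> i j; rewrite /f => fij; apply: val_inj; apply/eqP.
  rewrite -(nth_uniq (false, (0, 0)%N) _ _ codes_uniq);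
    rewrite ?size_codes ?(ltn_ord i) ?(ltn_ord j) //.
  move: (code_in i) (code_in j) fij; rewrite !mem_codes /code.
  case: (nth _ _ i) (nth _ _ j) => [s [p q]] [s' [p' q']] /=.
  move=> /andP[p4 q4] /andP[p'4 q'4].
  by case: s; case: s' => // -[] /eqP + /eqP;
     rewrite !F4_el_eq // => /eqP-> /eqP->.
- transitivity #|{: F * F + F * F}| => //; by rewrite card_sum card_prod F4.
- by move=> i j; rewrite entry_tabulate // H_vertexE.
Qed.

End FieldWithFourElements.

(** In a field with four elements, x^4 - x = x (x - 1) (x^2 + x + 1) vanishes
    everywhere, so an element other than 0 and 1 is a root of the last factor. *)
Lemma F4_exists : exists (F : finFieldType) (alpha : F),
  #|F| = 4 /\ (alpha ^+ 2 = alpha + 1)%R.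
Proof.
have [F ch2 F4] := pPrimePowerField (isT : prime 2) (isT : 0 < 2).
exists F.
have /allPn[alpha _] : ~~ all (mem [:: 0; 1]%R) (enum F).
  apply/negP=> /allP/(uniq_leq_size (enum_uniq F)).
  by rewrite -cardE F4.
rewrite !inE negb_or => /andP[a0 a1]; exists alpha; split=> //.
have : (alpha * (alpha - 1) * (alpha ^+ 2 + alpha + 1) = 0)%R.
  have -> : (alpha * (alpha - 1) * (alpha ^+ 2 + alpha + 1)
             = alpha ^+ 4 - alpha)%R by ring.
  by rewrite -[X in (_ ^+ X)%R](F4 : _ = 4) expf_card subrr.
move/eqP; rewrite !mulf_eq0 subr_eq0 (negPf a0) (negPf a1) /= -addrA.
by rewrite -[X in (_ + X)%R](oppr_pchar2 ch2) subr_eq0 => /eqP.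
Qed.

Lemma order32_minimal : egr_min_order 5 5 12 32.
Proof.
split; last by move=> w [T [e G]]; apply: egr_order_ge32 G.
have [F [alpha [F4 alpha2]]] := F4_exists.
by exists (vertex F), (H_rel alpha); apply: H_egr.
Qed.

Local Open Scope ring_scope.

Theorem theorem4p4 :
  (forall (F : finFieldType) (alpha : F),
      #|F| = 4%N -> alpha ^+ 2 = alpha + 1 ->
      extremal_egr (H_rel alpha) 32 5 5 12) /\
  egr_min_order 5 5 12 32.
Proof.
split; last exact: order32_minimal.
by move=> F alpha F4 alpha2; split; [apply: H_egr | apply: order32_minimal].
Qed.
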